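(* Let $G\in C^1(\mathbb R^{n+1}\setminus\{0\},\mathbb R^{(n+1)\times(n+1)})$ be a weight matrix, let $\Omega\subset\mathbb R^n$ be open, let $\mathcal H\in C^1(\mathbb R^{n+1},\mathbb R)$, and let $X\in C^3(\Omega,\mathbb R^{n+1})$ be an immersion with unit normal $N$ and of prescribed weighted mean curvature $\mathcal H$. Then there exist coefficients $P^i\in C^0(\Omega,\mathbb R)$, $i=1,\dots,n$, such that the normal $N$ satisfies $$\triangle_G N+\sum_{i=1}^n P^i\,\partial_i N+\Big(\mathrm{tr}(g^{-1}A_G S^2)-\langle\nabla\mathcal H,N\rangle\Big)N=-\nabla\mathcal H\quad\text{in }\Omega ,$$ where $\nabla\mathcal H$ is evaluated at $X$ and $\triangle_G$ is applied to $N$ componentwise.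
   Context: A weight matrix is a map $G=G(p)$ from $\mathbb R^{n+1}\setminus\{0\}$ to the symmetric real $(n+1)\times(n+1)$ matrices such that (i) $\langle G(p)y,y\rangle>0$ for all $p\neq 0$ and all $y\in p^\perp\setminus\{0\}$; (ii) $t\,G(tp)=G(p)$ and $G(p)p=0$ for all $p\ne0$, $t>0$. For an immersion $X:\Omega\to\mathbb R^{n+1}$ with (continuous) unit normal $N:\Omega\to S^n$ put $g_{ij}=\langle\partial_iX,\partial_jX\rangle$ (with inverse $g^{ij}$), $b_{ij}=\langle\partial_{ij}X,N\rangle$, $S=g^{-1}b$ (shape operator), and let $A_G=(a_{ij})$ be the weighted first fundamental form $a_{ij}=\langle G(N)\partial_iX,\partial_jX\rangle$. The weighted mean curvature is $H_G=\mathrm{tr}(g^{-1}A_GS)$. $X$ has prescribed weighted mean curvature $\mathcal H$ if $H_G(x)=\mathcal H(X(x))$ for all $x\in\Omega$. The weighted Laplace-Beltrami operator of $\psi\in C^2(\Omega,\mathbb R)$ is $\triangle_G\psi=\frac{1}{\sqrt{\det g}}\,\partial_i\big(\sqrt{\det g}\,g^{ij}a_{jk}g^{kl}\partial_l\psi\big)$ (summation over repeated indices from $1$ to $n$). *)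

(* Defs.v *)
From HB Require Import structures.
From mathcomp Require Import all_boot all_order all_algebra.
From mathcomp Require Import all_classical all_reals all_analysis.

Set Implicit Arguments.
Unset Strict Implicit.
Unset Printing Implicit Defensive.
Import Order.TTheory GRing.Theory Num.Theory.
Import numFieldNormedType.Exports.
Local Open Scope classical_set_scope.
Local Open Scope ring_scope.

(* Points and vectors of R^m are row vectors
   'rV[R]_m. The norm `|_| of 'rV[R]_m is the sup norm: it induces the usual
   topology, but Euclidean lengths have to be expressed with [dotv]. *)

Definition dotv (R : realType) (m : nat) (u v : 'rV[R]_m) : R :=
  (u *m v^T) 0 0.

(* The matrix A applied to the vector y in the usual (column) sense. *)
Definition appv (R : realType) (m : nat) (A : 'M[R]_m) (y : 'rV[R]_m) :
  'rV[R]_m := (A *m y^T)^T.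

Definition partial (R : realType) (m : nat) (V : normedModType R) (i : 'I_m)
  (f : 'rV[R]_m -> V) (x : 'rV[R]_m) : V := 'D_(delta_mx 0 i) f x.

(* For an open set D: all partial derivatives of order at most k exist and are
   continuous on D. The values of f outside D play no role. *)
Fixpoint Ck (R : realType) (m : nat) (V : normedModType R) (k : nat)
  (D : set 'rV[R]_m) (f : 'rV[R]_m -> V) : Prop :=
  match k with
  | 0 => forall x, D x -> {for x, continuous f}
  | k'.+1 => (forall x, D x -> {for x, continuous f}) /\
      forall i : 'I_m, (forall x, D x -> derivable f x (delta_mx 0 i)) /\
        Ck k' D (partial i f)
  end.

Definition grad (R : realType) (m : nat) (f : 'rV[R]_m -> R) (p : 'rV[R]_m) :
  'rV[R]_m := \row_(i < m) partial i f p.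

Definition weight_matrix (R : realType) (n : nat)
  (G : 'rV[R]_n.+1 -> 'M[R]_n.+1) : Prop :=
  [/\ forall p, p != 0 -> (G p)^T = G p,
      forall p y, p != 0 -> dotv y p = 0 -> y != 0 -> 0 < dotv (appv (G p) y) y,
      forall p (t : R), p != 0 -> 0 < t -> t *: G (t *: p) = G p
    & forall p, p != 0 -> appv (G p) p = 0].

Definition immersion (R : realType) (n : nat) (Omega : set 'rV[R]_n)
  (X : 'rV[R]_n -> 'rV[R]_n.+1) : Prop :=
  forall x, Omega x -> row_free (\matrix_(i < n) partial i X x).

Definition unit_normal (R : realType) (n : nat) (Omega : set 'rV[R]_n)
  (X N : 'rV[R]_n -> 'rV[R]_n.+1) : Prop :=
  forall x, Omega x -> [/\ {for x, continuous N}, dotv (N x) (N x) = 1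
    & forall i : 'I_n, dotv (partial i X x) (N x) = 0].

Definition fund1 (R : realType) (n : nat) (X : 'rV[R]_n -> 'rV[R]_n.+1)
  (x : 'rV[R]_n) : 'M[R]_n :=
  \matrix_(i < n, j < n) dotv (partial i X x) (partial j X x).

Definition fund2 (R : realType) (n : nat) (X N : 'rV[R]_n -> 'rV[R]_n.+1)
  (x : 'rV[R]_n) : 'M[R]_n :=
  \matrix_(i < n, j < n) dotv (partial i (partial j X) x) (N x).

Definition shape_op (R : realType) (n : nat) (X N : 'rV[R]_n -> 'rV[R]_n.+1)
  (x : 'rV[R]_n) : 'M[R]_n := invmx (fund1 X x) *m fund2 X N x.

Definition wfund1 (R : realType) (n : nat) (G : 'rV[R]_n.+1 -> 'M[R]_n.+1)
  (X N : 'rV[R]_n -> 'rV[R]_n.+1) (x : 'rV[R]_n) : 'M[R]_n :=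
  \matrix_(i < n, j < n) dotv (appv (G (N x)) (partial i X x)) (partial j X x).

Definition wmean_curv (R : realType) (n : nat) (G : 'rV[R]_n.+1 -> 'M[R]_n.+1)
  (X N : 'rV[R]_n -> 'rV[R]_n.+1) (x : 'rV[R]_n) : R :=
  \tr (invmx (fund1 X x) *m wfund1 G X N x *m shape_op X N x).

Definition prescribed_wmc (R : realType) (n : nat) (Omega : set 'rV[R]_n)
  (G : 'rV[R]_n.+1 -> 'M[R]_n.+1) (Hc : 'rV[R]_n.+1 -> R)
  (X N : 'rV[R]_n -> 'rV[R]_n.+1) : Prop :=
  forall x, Omega x -> wmean_curv G X N x = Hc (X x).

(* 'D_v is a total operator, so this expression is meaningful for psi of class
   C^2, with X of class C^2 and fund1 X, wfund1 G X N of class C^1. *)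
Definition wlaplace (R : realType) (n : nat) (G : 'rV[R]_n.+1 -> 'M[R]_n.+1)
  (X N : 'rV[R]_n -> 'rV[R]_n.+1) (psi : 'rV[R]_n -> R) (x : 'rV[R]_n) : R :=
  (Num.sqrt (\det (fund1 X x)))^-1 *
  \sum_(i < n) partial i (fun y : 'rV[R]_n => Num.sqrt (\det (fund1 X y)) *
    \sum_(j < n) \sum_(k < n) \sum_(l < n)
      invmx (fund1 X y) i j * wfund1 G X N y j k * invmx (fund1 X y) k l *
      partial l psi y) x.

Definition wlaplacev (R : realType) (n : nat) (G : 'rV[R]_n.+1 -> 'M[R]_n.+1)
  (X N : 'rV[R]_n -> 'rV[R]_n.+1) (f : 'rV[R]_n -> 'rV[R]_n.+1)
  (x : 'rV[R]_n) : 'rV[R]_n.+1 :=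
  \row_(c < n.+1) wlaplace G X N (fun y => f y 0 c) x.

(* Main.v *)
Require Import Defs.
From HB Require Import structures.
From mathcomp Require Import all_boot all_order all_algebra.
From mathcomp Require Import all_classical all_reals all_analysis.
From mathcomp Require Import ring.

Set Implicit Arguments.
Unset Strict Implicit.
Unset Printing Implicit Defensive.
Import Order.TTheory GRing.Theory Num.Theory.
Import numFieldNormedType.Exports.
Local Open Scope classical_set_scope.
Local Open Scope ring_scope.

(* Write E for the Jacobian of X (its rows are the X_i), K = g^-1 A_G g^-1 and
   H_G = tr(K b). By the product rule Delta_G N is tr(K D^2 N) plus a first-order
   term in N, so only tr(K D^2 N) has to be understood, and this is done against
   the frame (X_j, N), where E^T g^-1 E + N^T N = 1.
   Against N: differentiating <N_l, N> = 0 gives -tr(K DN DN^T), which is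
   -tr(g^-1 A_G S^2) by the Weingarten equations DN = -b g^-1 E.
   Against X_j: differentiate <N_l, X_j> = -b_lj and H_G = Hc(X); since third
   derivatives of X commute and G(N) N = 0, the third-order terms and all
   Christoffel-type terms cancel in <tr(K D^2 N) + grad Hc, X_j>. What remains
   is <Z, N_j> for a continuous field Z, and the symmetry of b rewrites it as
   a combination of the <N_m, X_j> with continuous coefficients. *)

(** * Directional derivatives and C^k maps *)

(** [Ck] speaks only of iterated partial derivatives, while the argument needs a chain rule for G(N)
    and Hc(X) and the symmetry of mixed derivatives; both are derived here from the mean value
    theorem on segments. Regularity is tight: [unit_normal] gives only continuity of N, so N must
    first be shown to be C^2; then b and A_G are C^1, which leaves room for exactly one derivative
    of H_G. The Christoffel terms cancel because the second derivatives of X, split along the frame,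
    enter the derivative of A_G through their tangential part alone. The coefficients P^i come from
    q = Z E^T g^-1: the vector with components <Z, N_j> is -(q b), whose j-th component is the sum
    of the q_m <N_m, X_j>. As the N_m are tangent, the sum of the q_m N_m is then the whole
    tangential part of tr(K D^2 N) + grad Hc. *)

Section MatrixValued.
Context {R : realType} {V : normedModType R} {m n : nat}.
Implicit Types (M : V -> 'M[R]_(m, n)) (x v : V).

Lemma is_derive_mxP M x v (dM : 'M[R]_(m, n)) :
  is_derive x v M dM <->
  forall i j, is_derive x v (fun y => M y i j) (dM i j).
Proof.
split=> [[dM1 dM2] i j|dM1].
  have dMij := (derivable_mxP _ _ _).1 dM1.
  by split=> //; rewrite -dM2 derive_mx// mxE.
have dM2 : derivable M x v by apply/derivable_mxP => i j; case: (dM1 i j).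
split=> //; rewrite derive_mx//; apply/matrixP => i j; rewrite mxE.
by case: (dM1 i j).
Qed.

Lemma derive_mxE M x v i j : derivable M x v ->
  ('D_v M x) i j = 'D_v (fun y => M y i j) x.
Proof. by move=> dM; rewrite derive_mx// mxE. Qed.

Lemma continuous_mxP (T : topologicalType) (M : T -> 'M[R]_(m, n)) (x : T) :
  {for x, continuous M} <->
  forall i j, {for x, continuous (fun y => M y i j)}.
Proof.
split=> [cM i j|cM].
  apply: (continuous_comp (f := M) (g := fun A : 'M[R]_(m, n) => A i j)) => //.
  exact: coord_continuous.
apply/cvgrPdist_le => /= e e0; near=> y.
rewrite /Num.Def.normr/= mx_normrE (bigmax_le _ (ltW e0))//= => i _.
rewrite !mxE/=.
move: i; near: y; apply: filter_forall => /= i.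
by move/cvgrPdist_le : (cM i.1 i.2); exact.
Unshelve. all: by end_near. Qed.

End MatrixValued.

Section DerivativeAlongLines.
Context {R : realType}.

(** Reduces a directional derivative to one real variable, where derivability and differentiability
    coincide. *)
Lemma is_derive1P (V W : normedModType R) (f : V -> W) (x v : V) (df : W) :
  is_derive x v f df <-> is_derive 0 (1 : R) (fun h => f (h *: v + x)) df.
Proof.
have E : 'D_v f x = 'D_1 (fun h : R => f (h *: v + x)) 0.
  rewrite /derive; congr (lim _).
  suff -> : (fun h => h^-1 *: ((f \o shift x) (h *: v) - f x)) =
    (fun h : R => h^-1 *: (((fun h => f (h *: v + x)) \o shift 0) (h *: 1) -
        f (0 *: v + x))) by [].
  by rewrite funeqE => h; rewrite /= addr0 [h *: 1]mulr1 scale0r add0r.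
split=> -[df1 df2]; split; rewrite -?df2 ?E//.
  exact: (derivable1P _ _ _).1.
exact: (derivable1P _ _ _).2.
Qed.

(** The inner map has a derivative in one direction only. Restricted to the line in that direction
    it becomes differentiable, and the ordinary chain rule for differentials applies. *)
Lemma is_derive_comp_diff (U V W : normedModType R) (f : V -> W) (c : U -> V)
    (x v : U) (dc : V) :
  is_derive x v c dc -> differentiable f (c x) ->
  is_derive x v (f \o c) ('d f (c x) dc).
Proof.
move=> /is_derive1P; set g := fun h : R => c (h *: v + x) => -[dg dgE] df.
have g0 : g 0 = c x by rewrite /g scale0r add0r.
apply/is_derive1P.
have {}dg : differentiable g 0 by exact/derivable1_diffP.
have dfg : differentiable (f \o g) 0.
  by apply: differentiable_comp => //; rewrite g0.
rewrite -[fun h => _]/(f \o g); split; first exact/derivable1_diffP.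
by rewrite deriveE// (diff_comp dg) ?g0//= -dgE deriveE.
Qed.

(** [is_derive1P] describes a line at parameter 0; precomposition with the affine map r -> s (r - t)
    moves it to parameter [t] and produces the factor [s]. *)
Lemma is_derive_line (V W : normedModType R) (f : V -> W) x v (t s : R) df :
  is_derive (x + (t * s) *: v) v f df ->
  is_derive t 1 (fun r : R => f (x + (r * s) *: v)) (s *: df).
Proof.
move=> /is_derive1P.
set g := fun h : R => f (h *: v + (x + (t * s) *: v)) => -[dg dgE].
pose l := s \*: (id - cst t : R -> R).
have dl : is_derive t 1 l s.
  by apply: is_derive_eq; rewrite subr0 [LHS]mulr1.
have l0 : l t = 0 by rewrite /l /= [_ t]subrr scaler0.
have {}dg : differentiable g 0 by exact/derivable1_diffP.
have := is_derive_comp_diff (f := g) dl; rewrite l0 => /(_ dg) H.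
rewrite (_ : (fun r => _) = g \o l).
  have -> : s *: df = 'd g 0 s.
    by rewrite -dgE deriveE// -linearZ/=; congr (diff _ _ _); rewrite [LHS]mulr1.
  exact: H.
rewrite funeqE => r; rewrite /g /l /= addrCA -scalerDl; congr (f (_ + _ *: _)).
by rewrite [s *: _]mulrC -mulrDl subrK.
Qed.


End DerivativeAlongLines.

(** * Mean value theorem on segments; continuous partial derivatives imply differentiability *)

Section MeanValue.
Context {R : realType}.

(** The segment is parametrized by r in [0, 1] as x + (r s) v, which treats both signs of [s] at
    once; hence the bounds in absolute value. *)
Lemma mvt_line (V : normedModType R) (f : V -> R) (x v : V) (s : R) :
  (forall t : R, `|t| <= `|s| -> derivable f (x + t *: v) v) ->
  exists2 t : R, `|t| <= `|s| & f (x + s *: v) - f x = s * 'D_v f (x + t *: v).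
Proof.
move=> df.
have dline (r : R) : r \in `[0, 1]%R ->
    is_derive r 1 (fun r : R => f (x + (r * s) *: v))
      (s * 'D_v f (x + (r * s) *: v)).
  rewrite in_itv/= => /andP[r0 r1]; apply: is_derive_line; apply: DeriveDef => //.
  by apply: df; rewrite normrM ger0_norm// ler_piMl.
set phi := fun r : R => f (x + (r * s) *: v) in dline *.
set dphi := fun r : R => s * 'D_v f (x + (r * s) *: v).
have le01 : (0 : R) <= 1 by exact: ler01.
have dphiP (r : R) : r \in `]0, 1[%R -> is_derive r 1 phi (dphi r).
  rewrite in_itv/= => /andP[r0 r1].
  by apply: dline; rewrite in_itv/= !ltW.
have cphi : {within `[0, 1], continuous phi}.
  by apply: derivable_within_continuous => r r01; case: (dline r r01).
have [r r01] := MVT_segment le01 dphiP cphi.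
rewrite /phi /dphi.
rewrite subr0 mulr1 mul1r mul0r scale0r addr0 => E; exists (r * s) => //.
move: r01; rewrite in_itv/= => /andP[r0 r1].
by rewrite normrM ger0_norm// ler_piMl.
Qed.

Lemma ler_norm_rV m (w w' : 'rV[R]_m) :
  (forall j, `|w 0 j| <= `|w' 0 j|) -> `|w| <= `|w'|.
Proof.
move=> ww'; rewrite [leLHS]/Num.Def.normr/= mx_normrE.
apply: bigmax_le => //= -[i j] _ /=; rewrite ord1; apply: le_trans (ww' j) _.
rewrite [leRHS]/Num.Def.normr/= mx_normrE.
exact: (le_bigmax _ (fun k : 'I_1 * 'I_m => `|w' k.1 k.2|) (0, j)).
Qed.

(* The increment of f is telescoped along the coordinate directions, and the
   mean value theorem is applied to each step. *)
Lemma differentiable_partial m (f : 'rV[R]_m -> R) (p : 'rV[R]_m) :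
  (\forall q \near p, forall i, derivable f q (delta_mx 0 i)) ->
  (forall i, {for p, continuous (partial i f)}) ->
  differentiable f p /\
  forall w, 'd f p w = \sum_(i < m) w 0 i * partial i f p.
Proof.
move=> df cf.
pose L (w : 'rV[R]_m) : R := \sum_(i < m) w 0 i * partial i f p.
have L_lin : linear L.
  move=> a u w; rewrite /L scaler_sumr -big_split/=; apply: eq_bigr => i _.
  by rewrite !mxE mulrDl -mulrA.
pose LM := GRing.isLinear.Build _ _ _ _ L L_lin.
pose LL : {linear 'rV[R]_m -> R} := HB.pack L LM.
have L_cont : continuous LL.
  move=> w; apply: differentiable_continuous.
  rewrite (_ : LL = \sum_(i < m) (fun w : 'rV[R]_m => w 0 i * partial i f p) :> (_ -> _)).
    by apply: differentiable_sum => i; apply: differentiableM => //;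
      exact: differentiable_coord.
  by rewrite funeqE => u; rewrite fct_sumE.
have key : f \o shift p = cst (f p) + LL +o_ (0 : 'rV[R]_m) id.
  apply: (eqaddoP _ _ _ _).2 => e e0.
  (* Each of the [m] coordinate steps may cost this fraction of the error; [m.+1] keeps the
     denominator nonzero when [m] is 0. *)
  have e'0 : 0 < e / m.+1%:R by rewrite divr_gt0.
  have : \forall q \near p, forall i, derivable f q (delta_mx 0 i) /\
      `|partial i f q - partial i f p| <= e / m.+1%:R.
    near=> q => i; split; first by move: i; near: q.
    rewrite distrC; move: i; near: q; apply: filter_forall => i.
    by move/cvgrPdist_le : (cf i); apply.
  move=> /nbhs_ballP[d /= d0 pd].
  near=> w.
  have wd : `|w| < d.
    by near: w; apply/nbhs_ballP; exists d => //= w; rewrite -ball_normE/= sub0r normrN.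
  (* [T k] keeps the first [k] coordinates of [w]. In the sup norm, truncation does not increase
     length, so the whole path from [p] to [p + w] stays in the ball. *)
  pose T k : 'rV[R]_m := \row_j (if (j < k)%N then w 0 j else 0).
  have TE (k : 'I_m) : T k.+1 = T k + w 0 k *: delta_mx 0 k.
    apply/rowP => j; rewrite !mxE eqxx/= ltnS leq_eqVlt -[j == k]/(j == k :> nat).
    by case: ltngtP => /=; rewrite ?mulr0 ?mulr1 ?addr0 ?add0r // => /ord_inj ->.
  have step (k : 'I_m) : `|f (p + T k.+1) - f (p + T k) - w 0 k * partial k f p|
      <= `|w| * (e / m.+1%:R).
    have inball (t : R) : `|t| <= `|w 0 k| -> ball p d (p + T k + t *: delta_mx 0 k).
      move=> tk; rewrite -ball_normE/= -addrA opprD addrA subrr sub0r normrN.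
      apply: le_lt_trans wd; apply: ler_norm_rV => j; rewrite !mxE eqxx/=.
      have [->|jk] := eqVneq j k; first by rewrite ltnn add0r mulr1.
      by rewrite mulr0 addr0; case: ifP => // _; rewrite normr0.
    have [t tk] := mvt_line (f := f) (x := p + T k) (v := delta_mx 0 k) (s := w 0 k)
      (fun t tk => (pd _ (inball t tk) k).1).
    rewrite TE addrA => ->; rewrite -mulrBr normrM.
    apply: ler_pM => //; last exact: (pd _ (inball t tk) k).2.
    rewrite [leRHS]/Num.Def.normr/= mx_normrE.
    exact: (le_bigmax _ (fun k : 'I_1 * 'I_m => `|w k.1 k.2|) (0, k)).
  rewrite /= -[X in `|X|]/(f (w + p) - (f p + L w)).
  have -> : f (w + p) - (f p + L w) =
      \sum_(k < m) (f (p + T k.+1) - f (p + T k) - w 0 k * partial k f p).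
    rewrite sumrB -/(L w) opprD addrA; congr (_ - _).
    rewrite -(big_mkord predT (fun k => f (p + T k.+1) - f (p + T k))).
    rewrite telescope_sumr//; congr (f _ - f _).
      by rewrite addrC; congr (_ + _); apply/rowP => j; rewrite mxE ltn_ord.
    by rewrite -[LHS]addr0; congr (_ + _); apply/rowP => j; rewrite !mxE.
  apply: le_trans (ler_norm_sum _ _ _) _.
  apply: le_trans (ler_sum _ (fun k _ => step k)) _.
  rewrite sumr_const card_ord -[leLHS]mulr_natr -mulrA [leRHS]mulrC.
  apply: ler_wpM2l => //; rewrite mulrAC ler_pdivrMr// ler_pM2l// ler_nat.
  exact: leqnSn.
have dE := diff_unique L_cont key.
split; last by move=> w; rewrite dE.
apply/diff_locallyP; split; first by rewrite dE.
by rewrite dE.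
Unshelve. all: by end_near. Qed.

End MeanValue.

(** * Symmetry of mixed second derivatives *)

Section Schwarz.
Context {R : realType} {V : normedModType R}.

Lemma is_derive_shift_arg (W : normedModType R) (f : V -> W) (y w u : V) df :
  is_derive (y + w) u f df -> is_derive y u (fun z => f (z + w)) df.
Proof.
move=> /is_derive1P dfy; apply/is_derive1P.
rewrite (_ : (fun h => _) = fun h => f (h *: u + (y + w)))//.
by rewrite funeqE => h; rewrite addrA.
Qed.

(** The second difference is the increment along [u] of phi(y) = f(y + s v) - f(y). One mean value
    step along [u] turns it into an increment of ['D_u f] along [v], and a second step finishes. *)
Lemma second_difference (f : V -> R) (x u v : V) (s : R) :
  (forall a b : R, `|a| <= `|s| -> `|b| <= `|s| ->
    derivable f (x + a *: u + b *: v) u /\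
    derivable ('D_u f) (x + a *: u + b *: v) v) ->
  exists a b : R, [/\ `|a| <= `|s|, `|b| <= `|s| &
    f (x + s *: u + s *: v) - f (x + s *: u) - (f (x + s *: v) - f x) =
    s * (s * 'D_v ('D_u f) (x + a *: u + b *: v))].
Proof.
move=> df.
pose phi y : R := f (y + s *: v) - f y.
have dphi (t : R) : `|t| <= `|s| -> is_derive (x + t *: u) u phi
    ('D_u f (x + t *: u + s *: v) - 'D_u f (x + t *: u)).
  move=> ts; apply: is_deriveB.
    apply: is_derive_shift_arg; apply: DeriveDef => //.
    by case: (df t s ts).
  apply: DeriveDef => //.
  have zs : `|0 : R| <= `|s| by rewrite normr0.
  by have [] := df t 0 ts zs; rewrite scale0r addr0.
have [a sa phiE] := mvt_line (fun t ts => @ex_derive _ _ _ _ _ _ _ (dphi t ts)).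
have [b sb psiE] := mvt_line (f := 'D_u f) (x := x + a *: u) (v := v)
  (fun t ts => (df a t sa ts).2).
exists a, b; split=> //; rewrite -psiE -(@derive_val _ _ _ _ _ _ _ (dphi a sa)).
by rewrite -phiE.
Qed.

(** The second difference is symmetric in [u] and [v], so the two mixed derivatives agree at some
    pair of points arbitrarily close to [x]; continuity at [x] transfers the equality. *)
Lemma derive_comm (f : V -> R) (x u v : V) :
  (\forall y \near x, [/\ derivable f y u, derivable ('D_u f) y v,
    derivable f y v & derivable ('D_v f) y u]) ->
  {for x, continuous ('D_v ('D_u f))} -> {for x, continuous ('D_u ('D_v f))} ->
  'D_v ('D_u f) x = 'D_u ('D_v f) x.
Proof.
move=> df cvu cuv.
have third (r : R) : 0 < r -> r / 3 + r / 3 < r.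
  move=> r0; rewrite -mulr2n -[ltLHS]mulr_natr -mulrA gtr_pMr//.
  by rewrite mulrC ltr_pdivrMr// mul1r ltr_nat.
set A := LHS; set B := RHS; apply/eqP; rewrite -subr_eq0 -normr_eq0.
apply: contraT => AB; have {}AB : 0 < `|A - B| by rewrite lt_def AB/=.
(* With a third of the gap allowed for each of the two continuity errors, their sum stays strictly
   below the gap. *)
pose e := `|A - B| / 3.
have e0 : 0 < e by rewrite divr_gt0.
move/cvgrPdist_le : cvu => /(_ e e0) cvu.
move/cvgrPdist_le : cuv => /(_ e e0) cuv.
have [d /= d0 xd] := (nbhs_ballP _ _).1 (filterI df (filterI cvu cuv)).
(* Chosen so that s (|u| + |v| + 1) = d / 2, which keeps every point of the parallelogram in the
   ball; the summand 1 covers u = v = 0. *)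
pose s := d / 2 / (`|u| + `|v| + 1).
have uv0 : 0 < `|u| + `|v| + 1 by rewrite ltr_wpDl// addr_ge0.
have s0 : 0 < s by rewrite !divr_gt0.
have inball (a b : R) : `|a| <= `|s| -> `|b| <= `|s| -> ball x d (x + a *: u + b *: v).
  move=> sa sb; rewrite -ball_normE/= -addrA opprD addrA subrr sub0r normrN.
  apply: le_lt_trans (ler_normD _ _) _; rewrite !normrZ.
  rewrite (gtr0_norm s0) in sa sb.
  apply: (@le_lt_trans _ _ (s * (`|u| + `|v| + 1))).
    apply: (@le_trans _ _ (s * (`|u| + `|v|))); last by rewrite ler_pM2l// lerDl.
    by rewrite mulrDr lerD// ler_wpM2r.
  by rewrite divfK ?gt_eqF// ltr_pdivrMr// ltr_pMr// ltr1n.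
have [a [b [sa sb E1]]] := @second_difference f x u v s (fun a b sa sb =>
  let: conj (And4 p1 p2 _ _) _ := xd _ (inball a b sa sb) in conj p1 p2).
have [a' [b' [sa' sb' E2]]] := @second_difference f x v u s (fun a b sa sb =>
  let: conj (And4 _ _ p1 p2) _ := eq_ind_r (_ : V -> Prop) (xd _ (inball b a sb sa))
    (addrAC x _ _) in conj p1 p2).
have sn : s != 0 by rewrite gt_eqF.
have E : 'D_v ('D_u f) (x + a *: u + b *: v) = 'D_u ('D_v f) (x + b' *: u + a' *: v).
  rewrite (addrAC x (a' *: v)) (addrAC x (s *: v)) in E2.
  have E3 : f (x + s *: u + s *: v) - f (x + s *: u) - (f (x + s *: v) - f x) =
            f (x + s *: u + s *: v) - f (x + s *: v) - (f (x + s *: u) - f x).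
    by rewrite !opprB !addrA addrAC [RHS]addrAC; congr (_ + _); rewrite [RHS]addrAC.
  have E4 := etrans (etrans (esym E1) E3) E2.
  exact: (mulfI sn (mulfI sn E4)).
have [_ [ae _]] := xd _ (inball a b sa sb).
have [_ [_ be]] := xd _ (inball b' a' sb' sa').
have := lerD ae be; rewrite E -[X in _ + X]normrN => /(le_trans (ler_normD _ _)).
by rewrite opprB addrA subrK leNgt => /negP[]; exact: third.
Qed.

End Schwarz.

(** * Closure properties of the classes C^k *)

Section Ck.
Context {R : realType} {m : nat} (D : set 'rV[R]_m).

Section Basic.
Context {V : normedModType R}.
Implicit Types f g : 'rV[R]_m -> V.

Lemma Ck_continuous k f x : Ck k D f -> D x -> {for x, continuous f}.
Proof. by case: k => [|k]; [|move=> []]; auto. Qed.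

Lemma CkW k f : Ck k.+1 D f -> Ck k D f.
Proof.
elim: k f => [|k IH] f; first by case.
move=> [cf df]; split=> // i; case: (df i) => dfi Cf; split=> //.
exact: IH.
Qed.

Lemma Ck_is_derive k f i x : Ck k.+1 D f -> D x ->
  is_derive x (delta_mx 0 i) f (partial i f x).
Proof. by move=> [_ /(_ i)[df _]] Dx; apply: DeriveDef => //; exact: df. Qed.

Lemma Ck_partial k f i : Ck k.+1 D f -> Ck k D (partial i f).
Proof. by move=> [_ /(_ i)[]]. Qed.

Hypothesis D_open : open D.

Lemma open_near x : D x -> \forall y \near x, D y.
Proof. by move=> Dx; apply: open_nbhs_nbhs. Qed.

Lemma near_eq_open f g x : (forall y, D y -> f y = g y) -> D x ->
  \forall y \near x, f y = g y.
Proof. by move=> fg Dx; exact: filterS fg (open_near Dx). Qed.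

Lemma is_derive_ext f g x v df : (forall y, D y -> f y = g y) -> D x ->
  is_derive x v f df -> is_derive x v g df.
Proof. by move=> fg Dx; apply: near_eq_is_derive; exact: near_eq_open. Qed.

Lemma continuous_ext f g x : (forall y, D y -> f y = g y) -> D x ->
  {for x, continuous f} -> {for x, continuous g}.
Proof.
move=> fg Dx cf; rewrite /prop_for /continuous_at -(fg _ Dx); apply: cvg_trans cf.
exact: (near_eq_cvg (F := nbhs x) (near_eq_open fg Dx)).
Qed.

(** On an open set, agreement on [D] is agreement near each of its points, so it is inherited by
    partial derivatives. This permits replacing a map by a formula valid only on [D]. *)
Lemma Ck_ext k f g : (forall y, D y -> f y = g y) -> Ck k D f -> Ck k D g.
Proof.
elim: k f g => [|k IH] f g fg.
  by move=> cf x Dx; exact: continuous_ext fg Dx (cf x Dx).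
move=> Cf; split=> [x Dx|i]; first exact: continuous_ext fg Dx (Ck_continuous Cf Dx).
split=> [x Dx|]; first by case: (is_derive_ext fg Dx (Ck_is_derive i Cf Dx)).
apply: IH (Ck_partial i Cf) => y Dy.
by apply: near_eq_derive; exact: near_eq_open.
Qed.

(** The induction step of the closure lemmas: with an explicit formula for the partial derivatives,
    order [k.+1] reduces to order [k] of that formula. *)
Lemma Ck_intro k f (df : 'I_m -> 'rV[R]_m -> V) :
  (forall x, D x -> {for x, continuous f}) ->
  (forall i x, D x -> is_derive x (delta_mx 0 i) f (df i x)) ->
  (forall i, Ck k D (df i)) -> Ck k.+1 D f.
Proof.
move=> cf dfP Cdf; split=> // i; split=> [x Dx|]; first by case: (dfP i x Dx).
by apply: Ck_ext (Cdf i) => y Dy; case: (dfP i y Dy).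
Qed.

End Basic.

Hypothesis D_open : open D.
Implicit Types f g : 'rV[R]_m -> R.

Lemma Ck_mxP k p q (M : 'rV[R]_m -> 'M[R]_(p, q)) :
  Ck k D M <-> forall i j, Ck k D (fun y => M y i j).
Proof.
elim: k M => [|k IH] M.
  split=> [cM i j x Dx|cM x Dx]; last by apply/continuous_mxP => i j; exact: (cM i j x Dx).
  by apply: (continuous_mxP _ _).1; exact: (cM x Dx).
split=> [CM i j|CM].
  apply: (Ck_intro D_open (df := fun l y => partial l M y i j)) => [x Dx|l x Dx|l].
  - by apply: (continuous_mxP _ _).1; exact: Ck_continuous CM Dx.
  - exact: (is_derive_mxP _ _ _ _).1 (Ck_is_derive l CM Dx) i j.
  - exact: (IH _).1 (Ck_partial l CM) i j.
apply: (Ck_intro D_open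
  (df := fun l y => \matrix_(i, j) partial l (fun y => M y i j) y)) => [x Dx|l x Dx|l].
- by apply/continuous_mxP => i j; exact: Ck_continuous (CM i j) Dx.
- by apply/is_derive_mxP => i j; rewrite mxE; exact: Ck_is_derive (CM i j) Dx.
- apply/IH => i j; apply: Ck_ext (Ck_partial l (CM i j)) => // y _.
  by rewrite mxE.
Qed.

Lemma Ck_cst (V : normedModType R) k (a : V) : Ck k D (cst a : _ -> V).
Proof.
elim: k a => [|k IH] a; first by move=> x _; exact: cst_continuous.
apply: (Ck_intro D_open (df := fun _ => cst 0)) => [x _|i].
- exact: cst_continuous.
- exact: IH.
Qed.

Lemma CkD k f g : Ck k D f -> Ck k D g -> Ck k D (fun y => f y + g y).
Proof.
elim: k f g => [|k IH] f g Cf Cg.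
  by move=> x Dx; apply: continuousD; [exact: (Cf x Dx)|exact: (Cg x Dx)].
apply: (Ck_intro D_open (df := fun i y => partial i f y + partial i g y))
  => [x Dx|i x Dx|i].
- by apply: continuousD; [exact: Ck_continuous Cf Dx|exact: Ck_continuous Cg Dx].
- exact: (is_deriveD (Ck_is_derive i Cf Dx) (Ck_is_derive i Cg Dx)).
- exact: IH (Ck_partial i Cf) (Ck_partial i Cg).
Qed.

Lemma CkM k f g : Ck k D f -> Ck k D g -> Ck k D (fun y => f y * g y).
Proof.
elim: k f g => [|k IH] f g Cf Cg.
  by move=> x Dx; apply: continuousM; [exact: (Cf x Dx)|exact: (Cg x Dx)].
apply: (Ck_intro D_open (df := fun i y => f y * partial i g y + g y * partial i f y))
  => [x Dx|i x Dx|i].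
- by apply: continuousM; [exact: Ck_continuous Cf Dx|exact: Ck_continuous Cg Dx].
- exact: (is_deriveM (Ck_is_derive i Cf Dx) (Ck_is_derive i Cg Dx)).
- apply: CkD; apply: IH; [exact: CkW|exact: Ck_partial|exact: CkW|exact: Ck_partial].
Qed.

Lemma CkN k f : Ck k D f -> Ck k D (fun y => - f y).
Proof.
move=> Cf; have := CkM (Ck_cst k (-1 : R)) Cf; apply: Ck_ext => // y _ /=.
by rewrite mulN1r.
Qed.

Lemma Ck_sum k (I : Type) (r : seq I) (P : pred I) (F : I -> 'rV[R]_m -> R) :
  (forall i, Ck k D (F i)) -> Ck k D (fun y => \sum_(i <- r | P i) F i y).
Proof.
move=> CF; elim: r => [|i r IH].
  by apply: Ck_ext (Ck_cst k (0 : R)) => // y _; rewrite big_nil.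
case Pi : (P i); last by apply: Ck_ext IH => // y _; rewrite big_cons Pi.
by apply: Ck_ext (CkD (CF i) IH) => // y _; rewrite big_cons Pi.
Qed.

Lemma Ck_prod k (I : Type) (r : seq I) (P : pred I) (F : I -> 'rV[R]_m -> R) :
  (forall i, Ck k D (F i)) -> Ck k D (fun y => \prod_(i <- r | P i) F i y).
Proof.
move=> CF; elim: r => [|i r IH].
  by apply: Ck_ext (Ck_cst k (1 : R)) => // y _; rewrite big_nil.
case Pi : (P i); last by apply: Ck_ext IH => // y _; rewrite big_cons Pi.
by apply: Ck_ext (CkM (CF i) IH) => // y _; rewrite big_cons Pi.
Qed.

(** The derivative is built from the reciprocal itself and a partial derivative of [f], both of
    order [k], so the induction closes; [Ck_sqrt] follows the same pattern. *)
Lemma CkV k f : (forall x, D x -> f x != 0) -> Ck k D f ->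
  Ck k D (fun y => (f y)^-1).
Proof.
move=> f0; elim: k => [|k IH] Cf.
  by move=> x Dx; apply: continuousV; [exact: f0|exact: (Cf x Dx)].
apply: (Ck_intro D_open (df := fun i y => - ((f y)^-1 * (f y)^-1) * partial i f y))
  => [x Dx|i x Dx|i].
- by apply: continuousV; [exact: f0|exact: Ck_continuous Cf Dx].
- have [df <-] := Ck_is_derive i Cf Dx.
  by apply: DeriveDef; [exact: derivableV (f0 x Dx) df|rewrite deriveV ?f0// expr2 invfM].
- apply: CkM (Ck_partial i Cf); apply: CkN; apply: CkM; apply: IH; exact: CkW.
Qed.

Lemma Ck_sqrt k f : (forall x, D x -> 0 < f x) -> Ck k D f ->
  Ck k D (fun y => Num.sqrt (f y)).
Proof.
move=> f0; elim: k => [|k IH] Cf.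
  move=> x Dx; apply: (continuous_comp (g := Num.sqrt)); first exact: (Cf x Dx).
  exact: sqrt_continuous.
apply: (Ck_intro D_open (df := fun i y => (2 * Num.sqrt (f y))^-1 * partial i f y))
  => [x Dx|i x Dx|i].
- apply: (continuous_comp (g := Num.sqrt)); first exact: Ck_continuous Cf Dx.
  exact: sqrt_continuous.
- have /= sq := is_derive1_sqrt (f0 x Dx).
  have df : differentiable (Num.sqrt : R -> R) (f x) by apply/derivable1_diffP; case: sq.
  have := is_derive_comp_diff (Ck_is_derive i Cf Dx) df.
  rewrite (_ : 'd _ _ _ = (2 * Num.sqrt (f x))^-1 * partial i f x)//.
  rewrite -[partial i f x in LHS]mulr1 -[_ * 1]/(_ *: 1) linearZ/= -deriveE//.
  by rewrite mulrC; congr (_ * _); case: sq.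
- apply: CkM (Ck_partial i Cf); apply: CkV => [x Dx|].
    by rewrite mulf_neq0// gt_eqF// sqrtr_gt0 f0.
  by apply: CkM (IH (CkW Cf)); exact: Ck_cst.
Qed.

End Ck.

(** * Chain rule and commuting partial derivatives for C^k maps *)

Section Composition.
Context {R : realType}.

Lemma C1_differentiable p (E : set 'rV[R]_p) (f : 'rV[R]_p -> R) (y : 'rV[R]_p) :
  open E -> Ck 1 E f -> E y ->
  differentiable f y /\
  forall w, 'd f y w = \sum_(i < p) w 0 i * partial i f y.
Proof.
move=> E_open Cf Ey; apply: differentiable_partial => [|i].
  apply: filterS (open_near E_open Ey) => z Ez i.
  by case: (Ck_is_derive i Cf Ez).
exact: Ck_continuous (Ck_partial i Cf) Ey.
Qed.

Lemma is_derive_comp_partial p (V : normedModType R) (E : set 'rV[R]_p)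
    (f : 'rV[R]_p -> R) (c : V -> 'rV[R]_p) (x v : V) (dc : 'rV[R]_p) :
  open E -> Ck 1 E f -> E (c x) -> is_derive x v c dc ->
  is_derive x v (f \o c) (\sum_(i < p) dc 0 i * partial i f (c x)).
Proof.
move=> E_open Cf Ecx dcx.
have [df <-] := C1_differentiable E_open Cf Ecx.
exact: is_derive_comp_diff.
Qed.

Lemma Ck_comp p m (E : set 'rV[R]_p) (D : set 'rV[R]_m) k
    (f : 'rV[R]_p -> R) (c : 'rV[R]_m -> 'rV[R]_p) :
  open E -> open D -> (forall x, D x -> E (c x)) ->
  Ck k E f -> Ck k D c -> Ck k D (f \o c).
Proof.
move=> E_open D_open DE; elim: k f => [|k IH] f Cf Cc.
  move=> x Dx; apply: continuous_comp; first exact: (Cc x Dx).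
  exact: (Cf _ (DE x Dx)).
apply: (Ck_intro D_open (df := fun i y =>
  \sum_(l < p) partial i c y 0 l * partial l f (c y))) => [x Dx|i x Dx|i].
- apply: continuous_comp; first exact: Ck_continuous Cc Dx.
  exact: Ck_continuous Cf (DE x Dx).
- apply: (is_derive_comp_partial E_open _ (DE x Dx) (Ck_is_derive i Cc Dx)).
  (* Lowers [Ck k.+1 E f] to [Ck 1 E f], the form the chain rule asks for. *)
  by elim: (k) Cf => // j IHj /CkW.
- apply: Ck_sum => // l; apply: CkM => //.
    exact: (Ck_mxP D_open _ _).1 (Ck_partial i Cc) 0 l.
  by apply: IH; [exact: Ck_partial|exact: CkW].
Qed.

Lemma partial_comm m (D : set 'rV[R]_m) (f : 'rV[R]_m -> R) i j x :
  open D -> Ck 2 D f -> D x ->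
  partial i (partial j f) x = partial j (partial i f) x.
Proof.
move=> D_open Cf Dx.
apply: (derive_comm (u := delta_mx 0 j) (v := delta_mx 0 i)).
- apply: filterS (open_near D_open Dx) => z Dz; split.
  + by case: (Ck_is_derive j Cf Dz).
  + by case: (Ck_is_derive i (Ck_partial j Cf) Dz).
  + by case: (Ck_is_derive i Cf Dz).
  + by case: (Ck_is_derive j (Ck_partial i Cf) Dz).
- exact: Ck_continuous (Ck_partial i (Ck_partial j Cf)) Dx.
- exact: Ck_continuous (Ck_partial j (Ck_partial i Cf)) Dx.
Qed.

Lemma partial_mxE m p q (D : set 'rV[R]_m) k (M : 'rV[R]_m -> 'M[R]_(p, q)) l x a b :
  Ck k.+1 D M -> D x ->
  partial l M x a b = partial l (fun y => M y a b) x.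
Proof. by move=> CM Dx; rewrite /partial derive_mxE//; case: (Ck_is_derive l CM Dx). Qed.

Lemma partial_comm_mx m p q (D : set 'rV[R]_m) (M : 'rV[R]_m -> 'M[R]_(p, q)) i j x :
  open D -> Ck 2 D M -> D x ->
  partial i (partial j M) x = partial j (partial i M) x.
Proof.
move=> D_open CM Dx; apply/matrixP => a b.
have E l l' : partial l (fun y => partial l' M y a b) x =
              partial l (partial l' (fun y => M y a b)) x.
  apply: near_eq_derive; apply: near_eq_open Dx => // y Dy.
  exact: partial_mxE CM Dy.
apply: etrans (partial_mxE i a b (Ck_partial j CM) Dx) _.
apply: etrans (esym (partial_mxE j a b (Ck_partial i CM) Dx)).
apply: etrans (E i j) (etrans _ (esym (E j i))).
exact: partial_comm D_open ((Ck_mxP D_open _ _).1 CM a b) Dx.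
Qed.

End Composition.

(** * Calculus of matrix-valued maps *)

Section MatrixCalculus.
Context {R : realType}.

Lemma is_derive_sum_fun (V : normedModType R) n (h : 'I_n -> V -> R) x v dh :
  (forall i, is_derive x v (h i) (dh i)) ->
  is_derive x v (fun y => \sum_(i < n) h i y) (\sum_(i < n) dh i).
Proof.
move=> dhP; have := is_derive_sum dhP.
rewrite (_ : \sum_(i < n) h i = fun y => \sum_(i < n) h i y)//.
by rewrite funeqE => y; rewrite fct_sumE.
Qed.

Lemma is_derive_mulmx (V : normedModType R) p q r (A : V -> 'M[R]_(p, q))
    (B : V -> 'M[R]_(q, r)) x v dA dB :
  is_derive x v A dA -> is_derive x v B dB ->
  is_derive x v (fun y => A y *m B y) (dA *m B x + A x *m dB).
Proof.
move=> /is_derive_mxP dAP /is_derive_mxP dBP; apply/is_derive_mxP => i j.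
rewrite !mxE -big_split/=.
rewrite (_ : (fun y => _) = fun y => \sum_k A y i k * B y k j); last first.
  by rewrite funeqE => y; rewrite mxE.
apply: is_derive_sum_fun => k; rewrite addrC [dA i k * _]mulrC.
exact: (is_deriveM (dAP i k) (dBP k j)).
Qed.

Lemma is_derive_trmx (V : normedModType R) p q (A : V -> 'M[R]_(p, q)) x v dA :
  is_derive x v A dA -> is_derive x v (fun y => (A y)^T) dA^T.
Proof.
move=> /is_derive_mxP dAP; apply/is_derive_mxP => i j; rewrite mxE.
by rewrite (_ : (fun y => _) = fun y => A y j i)// funeqE => y; rewrite mxE.
Qed.

Lemma is_derive_mxtrace (V : normedModType R) p (A : V -> 'M[R]_p) x v dA :
  is_derive x v A dA -> is_derive x v (fun y => \tr (A y)) (\tr dA).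
Proof. by move=> /is_derive_mxP dAP; apply: is_derive_sum_fun => i. Qed.

(** Differentiating A A^-1 = 1 determines the derivative. Its existence is a hypothesis, which the
    cofactor formula behind [Ck_invmx] supplies in the application. *)
Lemma is_derive_invmx (V : normedModType R) p (A : V -> 'M[R]_p) x v dA dI :
  (\forall y \near x, A y \in unitmx) ->
  is_derive x v A dA -> is_derive x v (fun y => invmx (A y)) dI ->
  dI = - (invmx (A x) *m dA *m invmx (A x)).
Proof.
move=> uA dAP dIP; have dAI := is_derive_mulmx dAP dIP.
have dc : is_derive x v (fun y => A y *m invmx (A y)) (0 : 'M[R]_p).
  apply: near_eq_is_derive (is_derive_cst 1%:M x v).
  by apply: filterS uA => y uAy; rewrite mulmxV.
have /eqP : dA *m invmx (A x) + A x *m dI = 0.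
  by case: dc => _ <-; case: dAI.
rewrite addrC addr_eq0 => /eqP/(congr1 (mulmx (invmx (A x)))).
by rewrite mulKmx ?mulmxN ?mulmxA//; exact: (nbhs_singleton uA).
Qed.

Context {m : nat} (D : set 'rV[R]_m) (D_open : open D) (k : nat).

Lemma Ck_mulmx p q r (A : 'rV[R]_m -> 'M[R]_(p, q)) (B : 'rV[R]_m -> 'M[R]_(q, r)) :
  Ck k D A -> Ck k D B -> Ck k D (fun y => A y *m B y).
Proof.
move=> /(Ck_mxP D_open) CA /(Ck_mxP D_open) CB; apply/(Ck_mxP D_open) => i j.
have : Ck k D (fun y => \sum_l A y i l * B y l j).
  by apply: Ck_sum => // l; exact: CkM.
by apply: Ck_ext => // y _; rewrite mxE.
Qed.

Lemma Ck_trmx p q (A : 'rV[R]_m -> 'M[R]_(p, q)) :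
  Ck k D A -> Ck k D (fun y => (A y)^T).
Proof.
move=> /(Ck_mxP D_open) CA; apply/(Ck_mxP D_open) => i j.
by apply: Ck_ext (CA j i) => // y _; rewrite mxE.
Qed.

Lemma Ck_det p (A : 'rV[R]_m -> 'M[R]_p) :
  Ck k D A -> Ck k D (fun y => \det (A y)).
Proof.
move=> /(Ck_mxP D_open) CA; apply: Ck_sum => // s; apply: CkM => //.
  exact: Ck_cst.
by apply: Ck_prod => // i.
Qed.

(** Cramer's rule: every entry of the inverse is a cofactor divided by the determinant, and
    determinants are polynomials in the entries. *)
Lemma Ck_invmx p (A : 'rV[R]_m -> 'M[R]_p) :
  (forall x, D x -> A x \in unitmx) ->
  Ck k D A -> Ck k D (fun y => invmx (A y)).
Proof.
move=> uA CA; apply/(Ck_mxP D_open) => i j.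
have : Ck k D (fun y => (\det (A y))^-1 *
    ((-1) ^+ (j + i) * \det (row' j (col' i (A y))))).
  apply: CkM => //; first apply: CkV => //.
  - by move=> x Dx; have := uA x Dx; rewrite unitmxE unitfE.
  - exact: Ck_det.
  apply: CkM => //; first exact: Ck_cst.
  apply: Ck_det; apply/(Ck_mxP D_open) => a b.
  have := (Ck_mxP D_open _ _).1 CA (lift j a) (lift i b).
  by apply: Ck_ext => // y _; rewrite !mxE.
by apply: Ck_ext => // y Dy; rewrite /invmx uA// !mxE.
Qed.

Lemma CkD_mx p q (A B : 'rV[R]_m -> 'M[R]_(p, q)) :
  Ck k D A -> Ck k D B -> Ck k D (fun y => A y + B y).
Proof.
move=> /(Ck_mxP D_open) CA /(Ck_mxP D_open) CB; apply/(Ck_mxP D_open) => i j.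
by apply: Ck_ext (CkD D_open (CA i j) (CB i j)) => // y _; rewrite mxE.
Qed.

Lemma CkZ_mx p q (a : 'rV[R]_m -> R) (A : 'rV[R]_m -> 'M[R]_(p, q)) :
  Ck k D a -> Ck k D A -> Ck k D (fun y => a y *: A y).
Proof.
move=> Ca /(Ck_mxP D_open) CA; apply/(Ck_mxP D_open) => i j.
by apply: Ck_ext (CkM D_open Ca (CA i j)) => // y _; rewrite mxE.
Qed.

End MatrixCalculus.

(** * The frame of a hypersurface *)

Lemma dotv_mx (R : realType) m (u v : 'rV[R]_m) : u *m v^T = (dotv u v)%:M.
Proof. exact: mx11_scalar. Qed.

Lemma dotvC (R : realType) m (u v : 'rV[R]_m) : dotv u v = dotv v u.
Proof. by rewrite /dotv -[u in LHS]trmxK -trmx_mul mxE. Qed.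

Lemma dotvE (R : realType) m (u v : 'rV[R]_m) : dotv u v = \sum_(i < m) u 0 i * v 0 i.
Proof. by rewrite /dotv mxE; apply: eq_bigr => i _; rewrite mxE. Qed.

Lemma dotv_eq0 (R : realType) m (u : 'rV[R]_m) : dotv u u = 0 -> u = 0.
Proof.
rewrite dotvE => /eqP; rewrite psumr_eq0 => [/allP u0|i _]; last exact: sqr_ge0.
apply/rowP => i; rewrite mxE; have /= := u0 i (mem_index_enum _).
by rewrite mulf_eq0 orbb => /eqP.
Qed.

Lemma mulmx_trE (R : realType) p q r (A : 'M[R]_(p, r)) (B : 'M[R]_(q, r)) i j :
  (A *m B^T) i j = dotv (row i A) (row j B).
Proof. by rewrite !mxE dotvE; apply: eq_bigr => k _; rewrite !mxE. Qed.

Section Frame.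
Context {R : realType} {n : nat} (E : 'M[R]_(n, n.+1)) (nu : 'rV[R]_n.+1).
Context (E_free : row_free E) (nu_unit : dotv nu nu = 1) (E_nu : E *m nu^T = 0).

(** A row v with v E E^T = 0 satisfies |v E|^2 = 0, hence v E = 0, and v = 0 by independence of the
    rows of [E]. *)
Lemma gram_unitmx : E *m E^T \in unitmx.
Proof.
rewrite -row_free_unit; apply/row_freeP.
have : kermx (E *m E^T) = 0.
  apply/row_matrixP => i; rewrite row0.
  set v := row i _.
  have vE : v *m (E *m E^T) = 0 by rewrite -row_mul mulmx_ker row0.
  have /dotv_eq0 : dotv (v *m E) (v *m E) = 0.
    by rewrite /dotv trmx_mul -mulmxA (mulmxA E) mulmxA vE mul0mx mxE.
  by move/eqP; rewrite -[0](mul0mx _ E) => /eqP /(row_free_inj E_free).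
by move/eqP; rewrite kermx_eq0 => /row_freeP.
Qed.

(** The left side is the projection onto the row space of [E] plus the projection onto the line of
    [nu]. It fixes the rows of [E] and [nu], and these n + 1 rows span the whole space. *)
Lemma frame_decomposition : E^T *m invmx (E *m E^T) *m E + nu^T *m nu = 1%:M.
Proof.
have nunu : nu *m nu^T = 1%:M by rewrite dotv_mx nu_unit.
have nuE : nu *m E^T = 0 by rewrite -[nu]trmxK -trmx_mul E_nu trmx0.
have full : row_full (col_mx E nu).
  have /eqP rk : row_free (col_mx E nu).
    apply/row_freeP; exists (row_mx (E^T *m invmx (E *m E^T)) nu^T).
    rewrite mul_col_row mulmxA (mulmxV gram_unitmx) E_nu mulmxA nuE mul0mx nunu.
    by rewrite -scalar_mx_block.
  by rewrite /row_full rk addn1.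
have /row_fullP[B BE] := full.
set P := LHS.
have EP : col_mx E nu *m P = col_mx E nu.
  rewrite mul_col_mx !mulmxDr !mulmxA.
  by rewrite (mulmxV gram_unitmx) E_nu nuE nunu !mul0mx !mul1mx addr0 add0r.
by rewrite -[P]mul1mx -BE -mulmxA EP.
Qed.

End Frame.

(** [Ck] is a condition at each point on the ambient map, so the witness set may change with the
    point. This serves [Ck_normal], where the smooth formula for N is only local. *)
Lemma Ck_local (R : realType) m (V : normedModType R) k (D : set 'rV[R]_m)
    (f : 'rV[R]_m -> V) :
  (forall x, D x -> exists2 U : set 'rV[R]_m, U x & Ck k U f) -> Ck k D f.
Proof.
elim: k f => [|k IH] f Uf.
  by move=> x /Uf[U Ux Cf]; exact: (Cf x Ux).
split=> [x /Uf[U Ux Cf]|i]; first exact: Ck_continuous Cf Ux.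
split=> [x /Uf[U Ux Cf]|]; first by case: (Ck_is_derive i Cf Ux).
by apply: IH => x /Uf[U Ux Cf]; exists U => //; exact: Ck_partial.
Qed.

Lemma Ck_sub (R : realType) m (V : normedModType R) k (D D' : set 'rV[R]_m)
    (f : 'rV[R]_m -> V) : D' `<=` D -> Ck k D f -> Ck k D' f.
Proof. by move=> DD' Cf; apply: Ck_local => x /DD' Dx; exists D. Qed.

Definition jacmx (R : realType) m p (f : 'rV[R]_m -> 'rV[R]_p) (x : 'rV[R]_m) :
  'M[R]_(m, p) := \matrix_(i < m) partial i f x.

Lemma Ck_jacmx (R : realType) m p k (D : set 'rV[R]_m) (f : 'rV[R]_m -> 'rV[R]_p) :
  open D -> Ck k.+1 D f -> Ck k D (jacmx f).
Proof.
move=> D_open Cf; apply/Ck_mxP => // i j.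
apply: Ck_ext ((Ck_mxP D_open _ _).1 (Ck_partial i Cf) 0 j) => // y _.
by rewrite mxE.
Qed.

Section Surface.
Context {R : realType} {n : nat} (Omega : set 'rV[R]_n) (Omega_open : open Omega).
Context (X N : 'rV[R]_n -> 'rV[R]_n.+1).
Context (X_imm : immersion Omega X) (N_normal : unit_normal Omega X N).

Lemma fund1E x : fund1 X x = jacmx X x *m (jacmx X x)^T.
Proof. by apply/matrixP => i j; rewrite mulmx_trE mxE !rowK. Qed.

Lemma jacmx_normal x : Omega x -> jacmx X x *m (N x)^T = 0.
Proof.
move=> Ox; have [_ _ XN] := N_normal Ox.
by apply/matrixP => i j; rewrite mulmx_trE rowK mxE ord1 row_id XN.
Qed.

Lemma normal_unit x : Omega x -> dotv (N x) (N x) = 1.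
Proof. by move=> Ox; case: (N_normal Ox). Qed.

Lemma fund1_unit x : Omega x -> fund1 X x \in unitmx.
Proof. by move=> Ox; rewrite fund1E; apply: gram_unitmx; exact: X_imm. Qed.

Lemma surface_frame x : Omega x ->
  (jacmx X x)^T *m invmx (fund1 X x) *m jacmx X x + (N x)^T *m N x = 1%:M.
Proof.
move=> Ox; rewrite fund1E.
exact: frame_decomposition (X_imm Ox) (normal_unit Ox) (jacmx_normal Ox).
Qed.

Lemma Ck_fund1 k : Ck k.+1 Omega X -> Ck k Omega (fund1 X).
Proof.
move=> CX; have CE := Ck_jacmx Omega_open CX.
apply: Ck_ext (Ck_mulmx Omega_open CE (Ck_trmx Omega_open CE)) => // y _.
by rewrite fund1E.
Qed.

Lemma Ck_invfund1 k : Ck k.+1 Omega X -> Ck k Omega (fun y => invmx (fund1 X y)).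
Proof. by move=> CX; apply: Ck_invmx => //; [exact: fund1_unit|exact: Ck_fund1]. Qed.

Lemma Ck_dotv k (U : set 'rV[R]_n) (u v : 'rV[R]_n -> 'rV[R]_n.+1) :
  open U -> Ck k U u -> Ck k U v -> Ck k U (fun y => dotv (u y) (v y)).
Proof.
move=> U_open Cu Cv.
exact: (Ck_mxP U_open _ _).1 (Ck_mulmx U_open Cu (Ck_trmx U_open Cv)) 0 0.
Qed.

(* Near x0, N is the normalization of the component of the fixed vector N x0
   that is orthogonal to the tangent space, hence as smooth as the frame. *)
Lemma Ck_normal k : Ck k.+1 Omega X -> Ck k Omega N.
Proof.
move=> CX; apply: Ck_local => x0 Ox0.
pose h y := dotv (N x0) (N y).
have h_cont x : Omega x -> {for x, continuous h}.
  apply: (Ck_continuous (k := 0)).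
  apply: (Ck_dotv (k := 0) Omega_open (Ck_cst Omega_open 0 (N x0))) => y Oy.
  by case: (N_normal Oy).
(* The normal part of [N x0] at [y] is h(y) N(y), of length |h(y)|; positivity of [h] guarantees
   that normalizing it returns N and not -N. *)
pose U := [set y | Omega y /\ 0 < h y].
have U_open : open U.
  rewrite openE => y [Oy hy]; apply: filterI; first exact: open_near.
  exact: (cvgr_gt (h y) (h_cont y Oy) 0 hy).
have UO : U `<=` Omega by move=> y [].
exists U; first by split=> //; rewrite /h normal_unit.
pose w y := N x0 + (-1 : R) *:
  (N x0 *m ((jacmx X y)^T *m invmx (fund1 X y) *m jacmx X y)).
have wE y : U y -> w y = h y *: N y.
  move=> [Oy _]; have /eqP := surface_frame Oy; rewrite addrC eq_sym -subr_eq => /eqP.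
  move=> /(congr1 (mulmx (N x0))); rewrite mulmxBr mulmx1 /w scaleN1r => ->.
  by rewrite mulmxA dotv_mx mul_scalar_mx.
have wwE y : U y -> dotv (w y) (w y) = h y ^+ 2.
  move=> Uy; rewrite wE// /dotv linearZ/= -scalemxAl -scalemxAr dotv_mx.
  by rewrite normal_unit ?scale_scalar_mx ?mxE ?mulr1//; case: Uy.
have Cw : Ck k U w.
  apply: CkD_mx => //; first exact: Ck_cst.
  apply: CkZ_mx => //; first exact: Ck_cst.
  have CE : Ck k U (jacmx X) by apply: Ck_sub UO _; exact: Ck_jacmx.
  apply: Ck_mulmx => //; first exact: Ck_cst.
  do 2?apply: Ck_mulmx => //; first exact: Ck_trmx.
  by apply: Ck_sub UO _; exact: Ck_invfund1.
have ww_gt0 y : U y -> 0 < dotv (w y) (w y).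
  by move=> Uy; rewrite wwE// exprn_gt0//; case: Uy.
have : Ck k U (fun y => (Num.sqrt (dotv (w y) (w y)))^-1 *: w y).
  apply: CkZ_mx => //; apply: CkV => //.
    by move=> y Uy; rewrite gt_eqF// sqrtr_gt0 ww_gt0.
  by apply: Ck_sqrt => //; exact: Ck_dotv.
apply: Ck_ext => // y Uy; rewrite wwE// wE// sqrtr_sqr.
by case: Uy => _ hy; rewrite gtr0_norm// scalerA mulVf ?scale1r// gt_eqF.
Qed.

End Surface.

(** * Derivatives of inner products and of Jacobians *)

Section DotDerivative.
Context {R : realType}.

Lemma is_derive_dotv (V : normedModType R) p (u w : V -> 'rV[R]_p) x v du dw :
  is_derive x v u du -> is_derive x v w dw ->
  is_derive x v (fun y => dotv (u y) (w y)) (dotv du (w x) + dotv (u x) dw).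
Proof.
move=> du' dw'; have := is_derive_mulmx du' (is_derive_trmx dw').
by move=> /is_derive_mxP/(_ 0 0); rewrite mxE.
Qed.

Lemma partial_dotv m p (D : set 'rV[R]_m) (u w : 'rV[R]_m -> 'rV[R]_p) i x :
  Ck 1 D u -> Ck 1 D w -> D x ->
  partial i (fun y => dotv (u y) (w y)) x =
  dotv (partial i u x) (w x) + dotv (u x) (partial i w x).
Proof.
move=> Cu Cw Dx.
by have [_ <-] := is_derive_dotv (Ck_is_derive i Cu Dx) (Ck_is_derive i Cw Dx).
Qed.

Lemma partial_ext m (V : normedModType R) (D : set 'rV[R]_m)
    (f g : 'rV[R]_m -> V) i x :
  open D -> (forall y, D y -> f y = g y) -> D x -> partial i f x = partial i g x.
Proof. by move=> D_open fg Dx; apply: near_eq_derive; exact: near_eq_open fg Dx. Qed.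

Lemma partial_cst m (V : normedModType R) (a : V) i (x : 'rV[R]_m) :
  partial i (cst a) x = 0.
Proof. exact: derive_cst. Qed.

(** The i-th rows of the two sides differ in the order of the i-th and j-th derivatives, so this is
    Schwarz's theorem. *)
Lemma partial_jacmx m p (D : set 'rV[R]_m) (f : 'rV[R]_m -> 'rV[R]_p) j x :
  open D -> Ck 2 D f -> D x -> partial j (jacmx f) x = jacmx (partial j f) x.
Proof.
move=> D_open Cf Dx; apply/matrixP => i a.
rewrite (partial_mxE _ _ _ (Ck_jacmx D_open Cf) Dx) mxE.
rewrite (partial_comm_mx i j D_open Cf Dx).
apply: etrans (esym (partial_mxE j 0 a (Ck_partial i Cf) Dx)).
by apply: partial_ext D_open _ Dx => y _; rewrite mxE.
Qed.

Lemma dotvDl p (u v w : 'rV[R]_p) : dotv (u + v) w = dotv u w + dotv v w.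
Proof. by rewrite /dotv mulmxDl mxE. Qed.

Lemma dotvZl p a (u w : 'rV[R]_p) : dotv (a *: u) w = a * dotv u w.
Proof. by rewrite /dotv -scalemxAl mxE. Qed.

Lemma dotv_suml p (I : Type) (r : seq I) (P : pred I) (F : I -> 'rV[R]_p) w :
  dotv (\sum_(i <- r | P i) F i) w = \sum_(i <- r | P i) dotv (F i) w.
Proof. by rewrite /dotv mulmx_suml summxE. Qed.

End DotDerivative.

(** * Weingarten equations and second derivatives of the normal *)

Section SurfaceIdentities.
Context {R : realType} {n : nat} (Omega : set 'rV[R]_n) (Omega_open : open Omega).
Context (X N : 'rV[R]_n -> 'rV[R]_n.+1) (X_C3 : Ck 3 Omega X).
Context (X_imm : immersion Omega X) (N_normal : unit_normal Omega X N).

Let N_C2 : Ck 2 Omega N := Ck_normal Omega_open X_imm N_normal X_C3.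
Let N_C1 : Ck 1 Omega N := CkW N_C2.
Let dX_C2 j : Ck 2 Omega (partial j X) := Ck_partial j X_C3.
Let dX_C1 j : Ck 1 Omega (partial j X) := CkW (dX_C2 j).

Lemma fund2_sym x : Omega x -> (fund2 X N x)^T = fund2 X N x.
Proof.
move=> Ox; apply/matrixP => i j; rewrite !mxE.
by rewrite (partial_comm_mx i j Omega_open (CkW X_C3) Ox).
Qed.

Lemma dotv_partial_normal l j y : Omega y ->
  dotv (partial l N y) (partial j X y) = - fund2 X N y l j.
Proof.
move=> Oy; apply/eqP; rewrite -addr_eq0; apply/eqP; rewrite mxE [X in _ + X]dotvC.
rewrite -(partial_dotv l N_C1 (dX_C1 j) Oy).
rewrite -(partial_cst (0 : R) l y); apply: partial_ext Omega_open _ Oy => z Oz.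
by rewrite dotvC; case: (N_normal Oz).
Qed.

Lemma dotv_partial_normal_normal l y : Omega y ->
  dotv (partial l N y) (N y) = 0.
Proof.
move=> Oy; have := partial_dotv l N_C1 N_C1 Oy.
rewrite [X in _ + X]dotvC -mulr2n (_ : partial l _ y = 0).
  by move/eqP; rewrite eq_sym mulrn_eq0/= => /eqP.
rewrite -(partial_cst (1 : R) l y); apply: partial_ext Omega_open _ Oy => z Oz.
by case: (N_normal Oz).
Qed.

Lemma jacmx_normal_frame x : Omega x ->
  jacmx N x *m (jacmx X x)^T = - fund2 X N x.
Proof.
move=> Ox; apply/matrixP => i j.
by rewrite mulmx_trE !rowK dotv_partial_normal// [RHS]mxE.
Qed.

(** Expand the rows of DN in the frame: |N| = 1 removes the normal part, and the products with the
    X_j are the entries of -b. *)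
Lemma weingarten x : Omega x ->
  jacmx N x = - (fund2 X N x *m invmx (fund1 X x) *m jacmx X x).
Proof.
move=> Ox.
have NN : jacmx N x *m (N x)^T = 0.
  apply/matrixP => i j.
  by rewrite mulmx_trE rowK ord1 row_id dotv_partial_normal_normal// mxE.
rewrite -[LHS]mulmx1 -(surface_frame X_imm N_normal Ox) mulmxDr !mulmxA.
by rewrite NN mul0mx addr0 jacmx_normal_frame// !mulNmx.
Qed.

Lemma dotv_partial2_normal_tangent i l j x : Omega x ->
  dotv (partial i (partial l N) x) (partial j X x) =
  - dotv (partial i (partial l (partial j X)) x) (N x)
  - dotv (partial l (partial j X) x) (partial i N x)
  - dotv (partial l N x) (partial i (partial j X) x).
Proof.
move=> Ox; have := partial_dotv i (Ck_partial l N_C2) (dX_C1 j) Ox.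
have CXlj := Ck_partial l (dX_C2 j).
have := partial_dotv i CXlj N_C1 Ox.
set f := fun y => _; set h := fun y => _ => fE.
have -> : partial i h x = - partial i f x.
  rewrite /partial -deriveN; last first.
    by case: (is_derive_dotv (Ck_is_derive i CXlj Ox) (Ck_is_derive i N_C1 Ox)).
  apply: partial_ext Omega_open _ Ox => y Oy.
  by rewrite /h dotv_partial_normal// mxE.
by rewrite fE opprD => ->; rewrite addrK.
Qed.

Lemma dotv_partial2_normal_normal i l x : Omega x ->
  dotv (partial i (partial l N) x) (N x) = - dotv (partial l N x) (partial i N x).
Proof.
move=> Ox; apply/eqP; rewrite -addr_eq0; apply/eqP.
rewrite -(partial_dotv i (Ck_partial l N_C2) N_C1 Ox).
rewrite -(partial_cst (0 : R) i x); apply: partial_ext Omega_open _ Ox => y Oy.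
exact: dotv_partial_normal_normal.
Qed.

(** Two exchanges of derivatives bring the j-th one innermost, so that the third-order term has
    literally the form it has in [dotv_partial2_normal_tangent] and cancels against it. *)
Lemma partial_fund2 j i l x : Omega x ->
  is_derive x (delta_mx 0 j) (fun y => fund2 X N y i l)
    (dotv (partial i (partial l (partial j X)) x) (N x) +
     dotv (partial i (partial l X) x) (partial j N x)).
Proof.
move=> Ox.
have E : partial j (partial i (partial l X)) x = partial i (partial l (partial j X)) x.
  apply: etrans (partial_comm_mx j i Omega_open (dX_C2 l) Ox) _.
  apply: partial_ext Omega_open _ Ox => y Oy.
  exact: partial_comm_mx Omega_open (CkW X_C3) Oy.
have -> : (fun y => fund2 X N y i l) = fun y => dotv (partial i (partial l X) y) (N y).
  by rewrite funeqE => y; rewrite mxE.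
have H := is_derive_dotv (Ck_is_derive j (Ck_partial i (dX_C2 l)) Ox)
  (Ck_is_derive j N_C1 Ox).
exact: (is_derive_eq H (congr1 (fun z => dotv z (N x) +
  dotv (partial i (partial l X) x) (partial j N x)) E)).
Qed.

End SurfaceIdentities.

(** * The weighted tensor and the equation of the normal *)

Lemma open_neq0 (R : realType) p : open [set v : 'rV[R]_p | v != 0].
Proof.
rewrite openE => v /= v0; apply/nbhs_ballP; exists `|v|; first by rewrite /= normr_gt0.
move=> w; rewrite -ball_normE/= => vw; apply/eqP => w0.
by move: vw; rewrite w0 subr0 ltxx.
Qed.

Lemma trace_sum_mul (R : realType) p q (A : 'M[R]_(p, q)) (B : 'M[R]_(q, p)) :
  \tr (A *m B) = \sum_i \sum_l A i l * B l i.
Proof. by apply: eq_bigr => i _; rewrite mxE. Qed.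

(* For the tensor K = gi A gi, with g' = c + c^T and A' = c gi A + Q + A gi c^T:
   half of the terms produced by A' cancel against those produced by gi'. *)
Lemma trace_derive_tensor (R : realType) n (gi A b c Q : 'M[R]_n) :
  gi^T = gi -> A^T = A -> b^T = b ->
  let dgi := - (gi *m (c + c^T) *m gi) in
  let dA := c *m gi *m A + Q + A *m gi *m c^T in
  \tr (((dgi *m A + gi *m dA) *m gi + gi *m A *m dgi) *m b) =
  \tr (gi *m Q *m gi *m b) - \tr (gi *m A *m gi *m c *m gi *m b) *+ 2.
Proof.
move=> giT AT bT dgi dA.
set t1 := \tr (gi *m c *m gi *m A *m gi *m b).
set t2 := \tr (gi *m c^T *m gi *m A *m gi *m b).
set t3 := \tr (gi *m Q *m gi *m b).
set t4 := \tr (gi *m A *m gi *m c^T *m gi *m b).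
set t5 := \tr (gi *m A *m gi *m c *m gi *m b).
(* By transposition and cyclicity of the trace. In the total, [t1] and [t4] cancel and t3 - t2 - t5
   remains, which explains the factor 2. *)
have t25 : t2 = t5.
  rewrite /t2 -mxtrace_tr !trmx_mul giT AT bT trmxK.
  by rewrite mxtrace_mulC !mulmxA.
have e1 : \tr (dgi *m A *m gi *m b) = - (t1 + t2).
  by rewrite /dgi !mulNmx linearN/= mulmxDr !mulmxDl linearD.
have e2 : \tr (gi *m dA *m gi *m b) = t1 + t3 + t4.
  by rewrite /dA !mulmxDr !mulmxDl !linearD/= !mulmxA.
have e3 : \tr (gi *m A *m dgi *m b) = - (t5 + t4).
  rewrite /dgi mulmxN mulNmx linearN/= mulmxDr mulmxDl mulmxDr mulmxDl.
  by rewrite linearD/= !mulmxA.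
rewrite mulmxDl (mulmxDl (dgi *m A)) (mulmxDl (dgi *m A *m gi)) !mxtraceD.
by rewrite e1 e2 e3 t25; ring.
Qed.

Section WeightedSurface.
Context {R : realType} {n : nat} (Omega : set 'rV[R]_n) (Omega_open : open Omega).
Context (X N : 'rV[R]_n -> 'rV[R]_n.+1) (X_C3 : Ck 3 Omega X).
Context (X_imm : immersion Omega X) (N_normal : unit_normal Omega X N).
Context (G : 'rV[R]_n.+1 -> 'M[R]_n.+1) (G_C1 : Ck 1 [set p | p != 0] G).
Context (G_weight : weight_matrix G).

Let N_C2 : Ck 2 Omega N := Ck_normal Omega_open X_imm N_normal X_C3.
Let N_C1 : Ck 1 Omega N := CkW N_C2.
Let E_C2 : Ck 2 Omega (jacmx X) := Ck_jacmx Omega_open X_C3.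
Let E_C1 : Ck 1 Omega (jacmx X) := CkW E_C2.
Let gi y := invmx (fund1 X y).
Let gi_C1 : Ck 1 Omega gi := CkW (Ck_invfund1 Omega_open X_imm X_C3).

Definition wtensor (y : 'rV[R]_n) : 'M[R]_n := gi y *m wfund1 G X N y *m gi y.

Lemma normal_neq0 y : Omega y -> N y != 0.
Proof.
move=> Oy; apply/eqP => N0; have := normal_unit N_normal Oy.
by rewrite N0 /dotv mul0mx mxE => /eqP; rewrite eq_sym oner_eq0.
Qed.

Lemma weight_normal_sym y : Omega y -> (G (N y))^T = G (N y).
Proof. by move=> Oy; case: G_weight => Gsym _ _ _; apply: Gsym; exact: normal_neq0. Qed.

Lemma weight_normal y : Omega y -> N y *m G (N y) = 0.
Proof.
move=> Oy; case: G_weight => _ _ _ /(_ _ (normal_neq0 Oy)).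
by rewrite /appv trmx_mul trmxK weight_normal_sym.
Qed.

Lemma wfund1E y : Omega y ->
  wfund1 G X N y = jacmx X y *m G (N y) *m (jacmx X y)^T.
Proof.
move=> Oy; apply/matrixP => i j.
by rewrite mulmx_trE mxE !rowK row_mul rowK /appv trmx_mul trmxK weight_normal_sym.
Qed.

Lemma wfund1_sym y : Omega y -> (wfund1 G X N y)^T = wfund1 G X N y.
Proof. by move=> Oy; rewrite wfund1E// !trmx_mul trmxK weight_normal_sym// mulmxA. Qed.

Lemma fund1_sym y : (fund1 X y)^T = fund1 X y.
Proof. by rewrite fund1E trmx_mul trmxK. Qed.

Lemma invfund1_sym y : (gi y)^T = gi y.
Proof. by rewrite /gi trmx_inv fund1_sym. Qed.

Lemma wtensor_sym y : Omega y -> (wtensor y)^T = wtensor y.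
Proof. by move=> Oy; rewrite /wtensor !trmx_mul invfund1_sym wfund1_sym// mulmxA. Qed.

(** Stated for an arbitrary matrix field because it is used twice: for [G] with k = 1 and for the
    merely continuous partial derivatives of [G] with k = 0. *)
Lemma Ck_weight_normal k : (k <= 1)%N -> forall H : 'rV[R]_n.+1 -> 'M[R]_n.+1,
  Ck k [set p | p != 0] H -> Ck k Omega (fun y => H (N y)).
Proof.
move=> k1 H CH; apply/Ck_mxP => // a b.
apply: (@Ck_comp _ _ _ [set p | p != 0] Omega k (fun p => H p a b) N) => //.
- exact: open_neq0.
- exact: normal_neq0.
- exact: (Ck_mxP (@open_neq0 R n.+1) _ _).1 CH a b.
- by case: k k1 {CH} => [|[|//]] _; [exact: CkW N_C1|exact: N_C1].
Qed.

Lemma Ck_wfund1 : Ck 1 Omega (wfund1 G X N).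
Proof.
have := Ck_mulmx Omega_open (Ck_mulmx Omega_open E_C1 (Ck_weight_normal (leqnn 1) G_C1))
  (Ck_trmx Omega_open E_C1).
by apply: Ck_ext => // y Oy; rewrite wfund1E.
Qed.

Lemma Ck_wtensor : Ck 1 Omega wtensor.
Proof. exact: Ck_mulmx (Ck_mulmx Omega_open gi_C1 Ck_wfund1) gi_C1. Qed.

Lemma is_derive_weight_normal j x : Omega x ->
  is_derive x (delta_mx 0 j) (fun y => G (N y))
    (\sum_(a < n.+1) (partial j N x) 0 a *: partial a G (N x)).
Proof.
move=> Ox; apply/is_derive_mxP => b c.
have := is_derive_comp_partial (@open_neq0 R n.+1)
  ((Ck_mxP (@open_neq0 R n.+1) _ _).1 G_C1 b c) (normal_neq0 Ox) (Ck_is_derive j N_C1 Ox).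
move/is_derive_eq; apply; rewrite summxE; apply: eq_bigr => a _.
rewrite [RHS]mxE; congr (_ * _); symmetry.
exact: partial_mxE G_C1 (normal_neq0 Ox).
Qed.

End WeightedSurface.

(** * Equation for tr(K D^2 N) along the surface *)

Section NormalEquation.
Context {R : realType} {n : nat} (Omega : set 'rV[R]_n) (Omega_open : open Omega).
Context (X N : 'rV[R]_n -> 'rV[R]_n.+1) (X_C3 : Ck 3 Omega X).
Context (X_imm : immersion Omega X) (N_normal : unit_normal Omega X N).
Context (G : 'rV[R]_n.+1 -> 'M[R]_n.+1) (G_C1 : Ck 1 [set p | p != 0] G).
Context (G_weight : weight_matrix G).
Context (Hc : 'rV[R]_n.+1 -> R) (Hc_C1 : Ck 1 setT Hc).
Context (X_pwmc : prescribed_wmc Omega G Hc X N).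

Let N_C2 : Ck 2 Omega N := Ck_normal Omega_open X_imm N_normal X_C3.
Let E_C2 : Ck 2 Omega (jacmx X) := Ck_jacmx Omega_open X_C3.
Let gi y := invmx (fund1 X y).
Let gi_C2 : Ck 2 Omega gi := Ck_invfund1 Omega_open X_imm X_C3.
Let A := wfund1 G X N.
Let b := fund2 X N.
Let K := wtensor X N G.

Lemma is_derive_jacmx j x : Omega x ->
  is_derive x (delta_mx 0 j) (jacmx X) (jacmx (partial j X) x).
Proof.
move=> Ox; have := Ck_is_derive j E_C2 Ox.
by move/is_derive_eq; apply; exact: partial_jacmx Omega_open (CkW X_C3) Ox.
Qed.

(** The j-th partial derivative of G(N), as given by the chain rule. *)
Definition dweight (j : 'I_n) (x : 'rV[R]_n) : 'M[R]_n.+1 :=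
  \sum_(a < n.+1) (partial j N x) 0 a *: partial a G (N x).

(** The entries of [c] are the products of the second derivatives of X with the X_m, that is,
    Christoffel symbols of the first kind; c + c^T is the j-th derivative of g. *)
Lemma is_derive_invfund1 j x : Omega x ->
  let c := jacmx (partial j X) x *m (jacmx X x)^T in
  is_derive x (delta_mx 0 j) gi (- (gi x *m (c + c^T) *m gi x)).
Proof.
move=> Ox c; have dE := is_derive_jacmx j Ox.
have dg : is_derive x (delta_mx 0 j) (fund1 X) (c + c^T).
  have -> : fund1 X = fun y => jacmx X y *m (jacmx X y)^T.
    by rewrite funeqE => y; exact: fund1E.
  apply: is_derive_eq (is_derive_mulmx dE (is_derive_trmx dE)) _.
  by rewrite /c trmx_mul trmxK.
have dgi := Ck_is_derive j gi_C2 Ox.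
apply: (is_derive_eq dgi); apply: (is_derive_invmx _ dg dgi).
by apply: filterS (open_near Omega_open Ox) => y; exact: fund1_unit.
Qed.

(** Insert the frame decomposition next to G(N) in the terms where E is differentiated: the normal
    part dies by G(N) N = 0, and the tangential part rebuilds A_G with a factor c g^-1. *)
Lemma is_derive_wfund1 j x : Omega x ->
  let c := jacmx (partial j X) x *m (jacmx X x)^T in
  is_derive x (delta_mx 0 j) A
    (c *m gi x *m A x + jacmx X x *m dweight j x *m (jacmx X x)^T
     + A x *m gi x *m c^T).
Proof.
move=> Ox c; have dE := is_derive_jacmx j Ox.
have dG := is_derive_weight_normal Omega_open X_C3 X_imm N_normal G_C1 j Ox.
have := is_derive_mulmx (is_derive_mulmx dE dG) (is_derive_trmx dE).
have E y : Omega y -> jacmx X y *m G (N y) *m (jacmx X y)^T = A y.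
  by move=> Oy; rewrite /A (wfund1E N_normal G_weight).
move/(is_derive_ext Omega_open E Ox)/is_derive_eq; apply.
set M := jacmx (partial j X) x.
have ME : M *m G (N x) *m (jacmx X x)^T = c *m gi x *m A x.
  rewrite -[M]mulmx1 -(surface_frame X_imm N_normal Ox) mulmxDr mulmxDl.
  rewrite -!mulmxA (weight_normal N_normal G_weight Ox) !mulmx0 addr0.
  by rewrite /c /A (wfund1E N_normal G_weight)// !mulmxA.
have EM : jacmx X x *m G (N x) *m M^T = A x *m gi x *m c^T.
  have giT : (gi x)^T = gi x := invfund1_sym X x.
  have AT : (A x)^T = A x := wfund1_sym N_normal G_weight Ox.
  have GT := weight_normal_sym N_normal G_weight Ox.
  have := congr1 trmx ME; rewrite (trmx_mul _ (A x)) (trmx_mul c) giT AT mulmxA => <-.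
  by rewrite trmx_mul (trmx_mul M) trmxK GT mulmxA.
by rewrite mulmxDl ME EM.
Qed.

(** Both sides are the j-th derivative of H_G, by the chain rule for Hc(X) on the left and the
    product rule for tr(K b) on the right. The three groups on the right come from the weight, from
    the Christoffel terms and from b. *)
Lemma grad_tangent j x : Omega x ->
  let c := jacmx (partial j X) x *m (jacmx X x)^T in
  dotv (grad Hc (X x)) (partial j X x) =
  \tr (gi x *m (jacmx X x *m dweight j x *m (jacmx X x)^T) *m gi x *m b x)
  - \tr (gi x *m A x *m gi x *m c *m gi x *m b x) *+ 2
  + \sum_i \sum_l K x i l *
      (dotv (partial i (partial l (partial j X)) x) (N x) +
       dotv (partial i (partial l X) x) (partial j N x)).
Proof.
move=> Ox c.
pose db : 'M[R]_n := \matrix_(i, l)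
  (dotv (partial i (partial l (partial j X)) x) (N x) +
   dotv (partial i (partial l X) x) (partial j N x)).
have dbP : is_derive x (delta_mx 0 j) b db.
  apply/is_derive_mxP => i l; rewrite mxE.
  exact: (partial_fund2 Omega_open X_C3 X_imm N_normal j i l Ox).
have dgi := is_derive_invfund1 j Ox.
have dA := is_derive_wfund1 j Ox.
have dK := is_derive_mulmx (is_derive_mulmx dgi dA) dgi.
have dKb := is_derive_mxtrace (is_derive_mulmx dK dbP).
have HE y : Omega y -> \tr (gi y *m A y *m gi y *m b y) = (Hc \o X) y.
  by move=> Oy; rewrite /= -X_pwmc// /wmean_curv /shape_op mulmxA.
have [_ dHE] := is_derive_ext Omega_open HE Ox dKb.
have := is_derive_comp_partial openT Hc_C1 I (Ck_is_derive j (CkW (CkW X_C3)) Ox).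
move=> [_]; rewrite -/(Hc \o X) dHE => dHE'.
have -> : dotv (grad Hc (X x)) (partial j X x) =
   \sum_(i < n.+1) partial j X x 0 i * partial i Hc (X x).
  by rewrite dotvC dotvE; apply: eq_bigr => i _; rewrite mxE.
rewrite -dHE' mxtraceD (trace_derive_tensor _ _ (invfund1_sym X x)
  (wfund1_sym N_normal G_weight Ox) (fund2_sym Omega_open N X_C3 Ox)); congr (_ + _).
have KT : (K x)^T = K x := wtensor_sym N_normal G_weight Ox.
rewrite -/(K x) mxtrace_mulC trace_sum_mul.
apply: eq_bigr => i _; apply: eq_bigr => l _.
have -> : K x l i = K x i l by rewrite -{1}KT mxE.
by rewrite [db i l]mxE mulrC.
Qed.

(** This is the third fundamental form. Weingarten is applied to one factor only; the other one,
    paired with the X_j, already gives -b. *)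
Lemma partial_normal_gram x : Omega x ->
  jacmx N x *m (jacmx N x)^T = b x *m gi x *m b x.
Proof.
move=> Ox; rewrite {2}(weingarten Omega_open X_C3 X_imm N_normal Ox).
rewrite linearN/= mulmxN !trmx_mul (invfund1_sym X x) (fund2_sym Omega_open N X_C3 Ox).
rewrite (mulmxA (jacmx N x)) (jacmx_normal_frame Omega_open X_C3 X_imm N_normal Ox).
by rewrite mulNmx opprK mulmxA.
Qed.

Definition trace_hess (x : 'rV[R]_n) : 'rV[R]_n.+1 :=
  \sum_i \sum_l K x i l *: partial i (partial l N) x.

Lemma dotv_trace_hess x w : dotv (trace_hess x) w =
  \sum_i \sum_l K x i l * dotv (partial i (partial l N) x) w.
Proof.
rewrite dotv_suml; apply: eq_bigr => i _; rewrite dotv_suml.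
by apply: eq_bigr => l _; rewrite dotvZl.
Qed.

Lemma trace_hess_normal x : Omega x ->
  dotv (trace_hess x) (N x) =
  - \tr (gi x *m A x *m (shape_op X N x *m shape_op X N x)).
Proof.
move=> Ox; rewrite dotv_trace_hess.
have -> : gi x *m A x *m (shape_op X N x *m shape_op X N x) =
    K x *m (jacmx N x *m (jacmx N x)^T).
  by rewrite partial_normal_gram// /K /wtensor /shape_op !mulmxA.
rewrite trace_sum_mul -sumrN; apply: eq_bigr => i _.
rewrite -sumrN; apply: eq_bigr => l _; rewrite -mulrN; congr (_ * _).
rewrite (dotv_partial2_normal_normal Omega_open X_C3 X_imm N_normal i l Ox).
by rewrite mulmx_trE !rowK.
Qed.

(** The two mixed terms of [dotv_partial2_normal_tangent] have the same trace since K is symmetric,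
    and Weingarten makes each the negative of the Christoffel trace of [grad_tangent]; the doubled
    traces therefore cancel in the sum. *)
Lemma trace_hess_tangent j x : Omega x ->
  let c := jacmx (partial j X) x *m (jacmx X x)^T in
  dotv (trace_hess x) (partial j X x) =
  \tr (gi x *m A x *m gi x *m c *m gi x *m b x) *+ 2
  - \sum_i \sum_l K x i l * dotv (partial i (partial l (partial j X)) x) (N x).
Proof.
move=> Ox c; rewrite dotv_trace_hess.
set M := jacmx (partial j X) x.
have KT : (K x)^T = K x := wtensor_sym N_normal G_weight Ox.
have E1 : \sum_i \sum_l K x i l * dotv (partial l (partial j X) x) (partial i N x)
    = \tr (K x *m (M *m (jacmx N x)^T)).
  rewrite trace_sum_mul; apply: eq_bigr => i _; apply: eq_bigr => l _.
  by rewrite mulmx_trE !rowK.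
have E2 : \sum_i \sum_l K x i l * dotv (partial l N x) (partial i (partial j X) x)
    = \tr (K x *m (M *m (jacmx N x)^T)).
  rewrite -mxtrace_tr trmx_mul KT trmx_mul trmxK mxtrace_mulC trace_sum_mul.
  apply: eq_bigr => i _; apply: eq_bigr => l _.
  by rewrite mulmx_trE !rowK.
have E3 : \tr (K x *m (M *m (jacmx N x)^T)) =
    - \tr (gi x *m A x *m gi x *m c *m gi x *m b x).
  rewrite (weingarten Omega_open X_C3 X_imm N_normal Ox).
  rewrite linearN/= !trmx_mul (invfund1_sym X x) (fund2_sym Omega_open N X_C3 Ox).
  by rewrite !mulmxN linearN/= /c !mulmxA.
transitivity (\sum_i \sum_l
  (- (K x i l * dotv (partial i (partial l (partial j X)) x) (N x))
   - K x i l * dotv (partial l (partial j X) x) (partial i N x)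
   - K x i l * dotv (partial l N x) (partial i (partial j X) x))).
  apply: eq_bigr => i _; apply: eq_bigr => l _.
  have D := dotv_partial2_normal_tangent Omega_open X_C3 X_imm N_normal i l j Ox.
  by apply: etrans (congr1 ( *%R (K x i l)) D) _; rewrite !mulrBr mulrN.
under eq_bigr do rewrite !sumrB sumrN.
by rewrite !sumrB sumrN E1 E2 E3 mulr2n; ring.
Qed.

(** The field Z of the overview. The first part collects the derivative of G(N) along N_j; the
    second is tr(K D^2 X), left over from differentiating N inside b. *)
Definition drift_covector (x : 'rV[R]_n) : 'rV[R]_n.+1 :=
  \row_a \tr (gi x *m (jacmx X x *m partial a G (N x) *m (jacmx X x)^T) *m gi x *m b x)
  + \sum_i \sum_l K x i l *: partial i (partial l X) x.

Lemma tangential_equation j x : Omega x ->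
  dotv (trace_hess x + grad Hc (X x)) (partial j X x) =
  dotv (drift_covector x) (partial j N x).
Proof.
move=> Ox; rewrite dotvDl trace_hess_tangent// grad_tangent//.
rewrite /drift_covector dotvDl [dotv (\sum_i _) _]dotv_suml.
have -> : dotv (\row_a \tr (gi x *m (jacmx X x *m partial a G (N x) *m (jacmx X x)^T) *m
    gi x *m b x)) (partial j N x) =
    \tr (gi x *m (jacmx X x *m dweight j x *m (jacmx X x)^T) *m gi x *m b x).
  rewrite dotvE /dweight mulmx_sumr mulmx_suml mulmx_sumr !mulmx_suml linear_sum/=.
  apply: eq_bigr => a _; rewrite mxE mulrC.
  by rewrite -!(scalemxAr, scalemxAl) linearZ.
have -> : \sum_i dotv (\sum_l K x i l *: partial i (partial l X) x) (partial j N x) =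
    \sum_i \sum_l K x i l * dotv (partial i (partial l X) x) (partial j N x).
  apply: eq_bigr => i _; rewrite dotv_suml; apply: eq_bigr => l _.
  by rewrite dotvZl.
have split (f g : 'I_n -> 'I_n -> R) : \sum_i \sum_l K x i l * (f i l + g i l) =
    \sum_i \sum_l K x i l * f i l + \sum_i \sum_l K x i l * g i l.
  rewrite -big_split; apply: eq_bigr => i _; rewrite -big_split.
  by apply: eq_bigr => l _; rewrite mulrDr.
by rewrite split; ring.
Qed.

(** The tangential products are Z DN^T = -Z E^T g^-1 b, by symmetry of g and b. Expanding in the
    frame multiplies them by g^-1 E, and -b g^-1 E is DN again, so only first derivatives of N
    appear. *)
Lemma trace_hess_equation x : Omega x ->
  trace_hess x + grad Hc (X x) =
  drift_covector x *m (jacmx X x)^T *m gi x *m jacmx N x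
  + (dotv (grad Hc (X x)) (N x)
     - \tr (gi x *m A x *m (shape_op X N x *m shape_op X N x))) *: N x.
Proof.
move=> Ox; set W := LHS.
have WE : W *m (jacmx X x)^T = - (drift_covector x *m (jacmx X x)^T *m gi x *m b x).
  transitivity (drift_covector x *m (jacmx N x)^T).
    apply/rowP => j; rewrite !mulmx_trE !row_id !rowK; exact: tangential_equation.
  rewrite (weingarten Omega_open X_C3 X_imm N_normal Ox).
  rewrite linearN/= !trmx_mul (invfund1_sym X x) (fund2_sym Omega_open N X_C3 Ox).
  by rewrite mulmxN !mulmxA.
rewrite -[W]mulmx1 -(surface_frame X_imm N_normal Ox) mulmxDr !mulmxA WE.
rewrite (weingarten Omega_open X_C3 X_imm N_normal Ox) dotv_mx mul_scalar_mx.
congr (_ + _ *: _); first by rewrite mulmxN !mulNmx !mulmxA.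
by rewrite dotvDl trace_hess_normal// addrC /shape_op !mulmxA.
Qed.

End NormalEquation.

(** The equality of sizes is a hypothesis because [col_mx E nu] has [n + 1] rows and [n.+1] columns,
    which are equal but not convertible. *)
Lemma det_mul_tr_ge0 (R : realType) p q (B : 'M[R]_(p, q)) :
  p = q -> 0 <= \det (B *m B^T).
Proof. by move=> pq; subst q; rewrite det_mulmx det_tr -expr2 sqr_ge0. Qed.

(** Adjoining [nu] to [E] gives a square matrix whose Gram matrix has diagonal blocks E E^T and 1;
    the determinant is thus a square, and it is nonzero since E E^T is invertible. *)
Lemma gram_det_gt0 (R : realType) n (E : 'M[R]_(n, n.+1)) (nu : 'rV[R]_n.+1) :
  row_free E -> dotv nu nu = 1 -> E *m nu^T = 0 -> 0 < \det (E *m E^T).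
Proof.
move=> E_free nu_unit E_nu.
have g0 : \det (E *m E^T) != 0 by rewrite -unitfE -unitmxE gram_unitmx.
rewrite lt_def g0/=.
have nuE : nu *m E^T = 0 by rewrite -[nu]trmxK -trmx_mul E_nu trmx0.
have := @det_mul_tr_ge0 _ _ _ (col_mx E nu) (addn1 n).
by rewrite tr_col_mx mul_col_row E_nu nuE dotv_mx nu_unit det_ublock det1 mulr1.
Qed.

(** * The weighted Laplacian of the normal, expanded by the product rule *)

Section Laplacian.
Context {R : realType} {n : nat} (Omega : set 'rV[R]_n) (Omega_open : open Omega).
Context (X N : 'rV[R]_n -> 'rV[R]_n.+1) (X_C3 : Ck 3 Omega X).
Context (X_imm : immersion Omega X) (N_normal : unit_normal Omega X N).
Context (G : 'rV[R]_n.+1 -> 'M[R]_n.+1) (G_C1 : Ck 1 [set p | p != 0] G).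
Context (G_weight : weight_matrix G).

Let N_C2 : Ck 2 Omega N := Ck_normal Omega_open X_imm N_normal X_C3.
Let vol y : R := Num.sqrt (\det (fund1 X y)).

Lemma det_fund1_gt0 y : Omega y -> 0 < \det (fund1 X y).
Proof.
move=> Oy; rewrite fund1E.
exact: gram_det_gt0 (X_imm Oy) (normal_unit N_normal Oy) (jacmx_normal N_normal Oy).
Qed.

Lemma vol_neq0 y : Omega y -> vol y != 0.
Proof. by move=> Oy; rewrite gt_eqF// sqrtr_gt0 det_fund1_gt0. Qed.

Lemma Ck_vol : Ck 1 Omega vol.
Proof.
apply: Ck_sqrt => //; first exact: det_fund1_gt0.
by apply: Ck_det => //; exact: Ck_fund1 (CkW X_C3).
Qed.

Definition wdensity y : 'M[R]_n := vol y *: wtensor X N G y.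

Lemma Ck_wdensity : Ck 1 Omega wdensity.
Proof.
exact: CkZ_mx Omega_open _ _ _ _ _ Ck_vol
  (Ck_wtensor Omega_open X_C3 X_imm N_normal G_C1 G_weight).
Qed.

(** Its l-th component is the sum over i of the i-th derivatives of sqrt(det g) K_il; divided by
    sqrt(det g), it gives the first-order coefficients of the operator. *)
Definition wdivergence x : 'rV[R]_n := \sum_i row i (partial i wdensity x).

Lemma wlaplacev_normal x : Omega x ->
  wlaplacev G X N N x =
  (vol x)^-1 *: wdivergence x *m jacmx N x + trace_hess X N G x.
Proof.
move=> Ox; apply/rowP => c; rewrite [LHS]mxE.
(* The flux in the definition of the operator is an entry of the density times DN, which opens the
   way to the matrix product rule. The equality holds on [Omega], enough to transfer derivatives at
   [x]. *)
have inner i y : Omega y -> (wdensity y *m jacmx N y) i c =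
  Num.sqrt (\det (fund1 X y)) *
    \sum_(j < n) \sum_(k < n) \sum_(l < n)
      invmx (fund1 X y) i j * wfund1 G X N y j k * invmx (fund1 X y) k l *
      partial l (fun y => N y 0 c) y.
  move=> Oy; rewrite /wdensity -scalemxAl mxE; congr (_ * _).
  have mulE p q r (B : 'M[R]_(p, q)) (C : 'M[R]_(q, r)) a d :
      (B *m C) a d = \sum_e B a e * C e d by rewrite mxE.
  rewrite /wtensor -!mulmxA mulE; apply: eq_bigr => j _.
  rewrite mulE mulr_sumr; apply: eq_bigr => k _.
  rewrite mulE !mulr_sumr; apply: eq_bigr => l _.
  rewrite !mulrA; congr (_ * _).
  rewrite [LHS]mxE; exact: (partial_mxE l 0 c N_C2 Oy).
have jN_C1 : Ck 1 Omega (jacmx N) := Ck_jacmx Omega_open N_C2.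
have dinner i : partial i (fun y => Num.sqrt (\det (fund1 X y)) *
    \sum_(j < n) \sum_(k < n) \sum_(l < n)
      invmx (fund1 X y) i j * wfund1 G X N y j k * invmx (fund1 X y) k l *
      partial l (fun y => N y 0 c) y) x =
   (row i (partial i wdensity x) *m jacmx N x) 0 c +
   \sum_l wdensity x i l * (partial i (partial l N) x) 0 c.
  have D := is_derive_mulmx (Ck_is_derive i Ck_wdensity Ox) (Ck_is_derive i jN_C1 Ox).
  have := is_derive_ext Omega_open (inner i) Ox ((is_derive_mxP _ _ _ _).1 D i c).
  move=> [_ dE]; apply: etrans dE _; rewrite mxE -row_mul [in RHS]mxE; congr (_ + _).
  rewrite mxE; apply: eq_bigr => l _; congr (_ * _).
  have E1 := partial_jacmx i Omega_open N_C2 Ox.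
  have E2 := partial_comm_mx l i Omega_open N_C2 Ox.
  apply: etrans (congr1 (fun M : 'M[R]_(n, n.+1) => M l c) E1) _.
  by rewrite mxE; exact: (congr1 (fun M : 'rV[R]_n.+1 => M 0 c) E2).
rewrite /wlaplace (eq_bigr _ (fun i _ => dinner i)).
rewrite big_split/= mulrDr -scalemxAl [RHS]mxE [X in _ = X + _]mxE; congr (_ + _).
  by rewrite /wdivergence mulmx_suml summxE.
rewrite /trace_hess summxE mulr_sumr; apply: eq_bigr => i _.
rewrite summxE mulr_sumr; apply: eq_bigr => l _.
by rewrite /wdensity !mxE !mulrA mulVf ?mul1r// vol_neq0.
Qed.

End Laplacian.

(** * The coefficients P^i and their continuity *)

Section Drift.
Context {R : realType} {n : nat} (Omega : set 'rV[R]_n) (Omega_open : open Omega).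
Context (X N : 'rV[R]_n -> 'rV[R]_n.+1) (X_C3 : Ck 3 Omega X).
Context (X_imm : immersion Omega X) (N_normal : unit_normal Omega X N).
Context (G : 'rV[R]_n.+1 -> 'M[R]_n.+1) (G_C1 : Ck 1 [set p | p != 0] G).
Context (G_weight : weight_matrix G).

Let N_C2 : Ck 2 Omega N := Ck_normal Omega_open X_imm N_normal X_C3.
Let E_C0 : Ck 0 Omega (jacmx X) := Ck_jacmx Omega_open (CkW (CkW X_C3)).
Let gi_C0 : Ck 0 Omega (fun y => invmx (fund1 X y)) :=
  Ck_invfund1 Omega_open X_imm (CkW (CkW X_C3)).
Let K_C0 : Ck 0 Omega (wtensor X N G) :=
  CkW (Ck_wtensor Omega_open X_C3 X_imm N_normal G_C1 G_weight).

Lemma Ck_mx_sum k p q (I : Type) (r : seq I) (F : I -> 'rV[R]_n -> 'M[R]_(p, q)) :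
  (forall i, Ck k Omega (F i)) -> Ck k Omega (fun y => \sum_(i <- r) F i y).
Proof.
move=> CF; apply/Ck_mxP => // a b.
have : Ck k Omega (fun y => \sum_(i <- r) F i y a b).
  by apply: Ck_sum => // i; exact: ((Ck_mxP Omega_open _ _).1 (CF i) a b).
by apply: Ck_ext => // y _; rewrite summxE.
Qed.

Lemma Ck_fund2 : Ck 0 Omega (fund2 X N).
Proof.
apply/Ck_mxP => // i j.
have := Ck_dotv Omega_open (Ck_partial i (Ck_partial j (CkW X_C3))) (CkW (CkW N_C2)).
by apply: Ck_ext => // y _; rewrite mxE.
Qed.

Lemma Ck_drift_covector : Ck 0 Omega (drift_covector X N G).
Proof.
apply: CkD_mx => //.
  apply/Ck_mxP => // i a.
  have CGa : Ck 0 Omega (fun y => partial a G (N y)).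
    exact: (Ck_weight_normal Omega_open X_C3 X_imm N_normal (leq0n 1)
      (Ck_partial a G_C1)).
  have C : Ck 0 Omega (fun y => invmx (fund1 X y) *m
     (jacmx X y *m partial a G (N y) *m (jacmx X y)^T) *m invmx (fund1 X y)
     *m fund2 X N y).
    exact: (Ck_mulmx Omega_open (Ck_mulmx Omega_open (Ck_mulmx Omega_open gi_C0
      (Ck_mulmx Omega_open (Ck_mulmx Omega_open E_C0 CGa) (Ck_trmx Omega_open E_C0)))
      gi_C0) Ck_fund2).
  have : Ck 0 Omega (fun y => \tr (invmx (fund1 X y) *m
     (jacmx X y *m partial a G (N y) *m (jacmx X y)^T) *m invmx (fund1 X y)
     *m fund2 X N y)).
    by apply: Ck_sum => // e; exact: ((Ck_mxP Omega_open _ _).1 C e e).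
  by apply: Ck_ext => // y _; rewrite mxE.
apply: Ck_mx_sum => i; apply: Ck_mx_sum => l; apply: CkZ_mx => //.
  exact: ((Ck_mxP Omega_open _ _).1 K_C0 i l).
exact: Ck_partial i (Ck_partial l (CkW X_C3)).
Qed.

(** The row of the P^i: the first term cancels the first-order part of the Laplacian of N, the
    second the tangential part found in [trace_hess_equation]. *)
Definition drift x : 'rV[R]_n :=
  - ((Num.sqrt (\det (fund1 X x)))^-1 *: wdivergence X N G x)
  - drift_covector X N G x *m (jacmx X x)^T *m invmx (fund1 X x).

Lemma Ck_drift : Ck 0 Omega drift.
Proof.
have Cvol : Ck 0 Omega (fun y => (Num.sqrt (\det (fund1 X y)))^-1).
  apply: (CkV Omega_open) => [x Ox|]; first exact: (vol_neq0 X_imm N_normal Ox).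
  exact: CkW (Ck_vol Omega_open X_C3 X_imm N_normal).
have Cdiv : Ck 0 Omega (wdivergence X N G).
  apply: Ck_mx_sum => i; apply/(Ck_mxP Omega_open) => a l.
  have := Ck_partial i (Ck_wdensity Omega_open X_C3 X_imm N_normal G_C1 G_weight).
  move=> /(Ck_mxP Omega_open) /(_ i l).
  by apply: (Ck_ext Omega_open) => y _; rewrite [RHS]mxE.
have Cq := Ck_mulmx Omega_open (Ck_mulmx Omega_open Ck_drift_covector
  (Ck_trmx Omega_open E_C0)) gi_C0.
have := CkZ_mx Omega_open (Ck_cst Omega_open 0 (-1 : R))
  (CkD_mx Omega_open (CkZ_mx Omega_open Cvol Cdiv) Cq).
by apply: (Ck_ext Omega_open) => y _; rewrite scaleN1r opprD.
Qed.

End Drift.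

Theorem theorem1 (R : realType) (n : nat)
  (G : 'rV[R]_n.+1 -> 'M[R]_n.+1)
  (G_C1 : Ck 1 [set p | p != 0] G) (G_weight : weight_matrix G)
  (Omega : set 'rV[R]_n) (Omega_open : open Omega)
  (Hc : 'rV[R]_n.+1 -> R) (Hc_C1 : Ck 1 setT Hc)
  (X N : 'rV[R]_n -> 'rV[R]_n.+1)
  (X_C3 : Ck 3 Omega X) (X_imm : immersion Omega X)
  (N_normal : unit_normal Omega X N)
  (X_pwmc : prescribed_wmc Omega G Hc X N) :
  exists P : 'I_n -> 'rV[R]_n -> R,
    (forall i : 'I_n, Ck 0 Omega (P i)) /\
    forall x : 'rV[R]_n, Omega x ->
      wlaplacev G X N N x + \sum_(i < n) P i x *: partial i N x
      + (\tr (invmx (fund1 X x) *m wfund1 G X N x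
               *m (shape_op X N x *m shape_op X N x))
         - dotv (grad Hc (X x)) (N x)) *: N x
      = - grad Hc (X x).
Proof.
exists (fun i x => drift X N G x 0 i); split=> [i|x Ox].
  exact: ((Ck_mxP Omega_open _ _).1
    (Ck_drift Omega_open X_C3 X_imm N_normal G_C1 G_weight) 0 i).
have -> : \sum_(i < n) drift X N G x 0 i *: partial i N x = drift X N G x *m jacmx N x.
  by rewrite mulmx_sum_row; apply: eq_bigr => i _; rewrite rowK.
rewrite (wlaplacev_normal Omega_open X_C3 X_imm N_normal G_C1 G_weight Ox).
have E := trace_hess_equation Omega_open X_C3 X_imm N_normal G_C1 G_weight
  Hc_C1 X_pwmc Ox.
(* The zeroth-order coefficient is written as the negative of the one in [E]. What remains is
   additive: T + g = D + Z implies (L + T) + (-L - D) - Z = -g. *)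
move: E; rewrite /drift mulmxBl mulNmx -[X in _ + X *: _ = - _]opprB scaleNr.
move: (_ *m jacmx N x) (_ *m jacmx N x) (trace_hess _ _ _ _) (_ *: N x) => L D T Z.
move: (grad Hc (X x)) => g E; have -> : Z = T + g - D by rewrite E addrC addKr.
by rewrite (addrC L) addrA addrK !opprD opprK addrACA addNr addr0 addrA subrr add0r.
Qed.
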